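(* Let $\mathbf{A}\in\mathbb{R}^{m\times n}$ have nonzero rows $a_1^T,\dots,a_m^T$, let $0\neq b\in\mathrm{Range}(\mathbf{A})$, $\lambda>0$, and let $\hat x$ be the unique solution of $\min_{x\in\mathbb{R}^n}\lambda\|x\|_1+\tfrac12\|x\|_2^2$ subject to $\mathbf{A}x=b$. Let the batch size satisfy $\eta>1$, let the probabilities $p_i$ and weights $w_i$ satisfy the coupling $\mathbf{P}\mathbf{W}\mathbf{D}^{-2}=\frac{\alpha}{\|\mathbf{A}\|_F^2}\mathbf{I}$ for a scalar $\alpha>0$, and assume $$0<\alpha<2\,\frac{\left(\eta-\tfrac12\sigma_{\max}(\mathbf{W})\right)\|\mathbf{A}\|_F^2}{\sigma_{\max}(\mathbf{A})^2(\eta-1)}.$$ Let $\gamma=\frac{1}{\tilde\sigma_{\min}^2(\mathbf{A})}\cdot\frac{|\hat x|_{\min}+2\lambda}{|\hat x|_{\min}}$, $$L(\alpha)=\alpha-\frac{\alpha}{2\eta}\left(\frac{\alpha}{\|\mathbf{A}\|_F^2}(\eta-1)\sigma_{\max}^2(\mathbf{A})+\sigma_{\max}(\mathbf{W})\right),\qquad q=1-\frac1\gamma\cdot\frac{L(\alpha)}{\|\mathbf{A}\|_F^2}.$$ Then $q\in(0,1)$, and the random iterates $(x_k,x_k^* )$ of the RSKA method converge in expectation with a linear rate to $\hat x$; more precisely, for all $k\ge 0$, $$\mathbb{E}\left[D_f^{x_{k+1}^*}(x_{k+1},\hat x)\right]\le q\cdot\mathbb{E}\left[D_f^{x_k^*}(x_k,\hat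 x)\right],\qquad \mathbb{E}\left[\|x_k-\hat x\|_2^2\right]\le 2\,q^k f(\hat x).$$
   Context: RSKA method (randomized sparse Kaczmarz with averaging): given $\mathbf{A}$, $b$, $\lambda$, a batch size $\eta\in\{1,2,\dots\}$, weights $w_1,\dots,w_m\in\mathbb{R}$ and probabilities $p_1,\dots,p_m$ with $\sum_i p_i=1$, set $x_0=x_0^*=0\in\mathbb{R}^n$ and for $k=0,1,2,\dots$ draw (independently of the past) $\eta$ indices $\tau_k$ from $\{1,\dots,m\}$ independently with replacement, index $i$ having probability $p_i$, and set $$x_{k+1}^*=x_k^*-\frac1\eta\sum_{i\in\tau_k}w_i\frac{\langle a_i,x_k\rangle-b_i}{\|a_i\|_2^2}a_i,\qquad x_{k+1}=S_\lambda(x_{k+1}^* ),$$ where the sum counts repeated indices with multiplicity and $S_\lambda(x)=\max\{|x|-\lambda,0\}\cdot\mathrm{sign}(x)$ acts componentwise. Notation: $f(x)=\lambda\|x\|_1+\tfrac12\|x\|_2^2$; for $x^*\in\partial f(x)$ the Bregman distance is $D_f^{x^*}(x,y)=f(y)-f(x)-\langle x^*,y-x\rangle$ (note $x_k=S_\lambda(x_k^* )$ means $x_k^*\in\partial f(x_k)$). $\mathbf{P}=\mathrm{Diag}(p_1,\dots,p_m)$, $\mathbf{W}=\mathrm{Diag}(w_1,\dots,w_m)$, $\mathbf{D}=\mathrm{Diag}(\|a_1\|_2,\dots,\|a_m\|_2)$. $\sigma_{\max}$ is the largest singular value, $\|\cdot\|_F$ the Frobenius norm. $\tilde\sigma_{\min}(\mathbf{A})=\min\{\sigma_{\min}(\mathbf{A}_J)\mid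 J\subseteq\{1,\dots,n\},\ \mathbf{A}_J\ne0\}$, where $\mathbf{A}_J$ is the submatrix of the columns indexed by $J$ and $\sigma_{\min}$ denotes the smallest nonzero singular value. $|x|_{\min}=\min\{|x_j|\mid x_j\neq0\}$. *)

(* Defs.v *)
From HB Require Import structures.
From mathcomp Require Import all_boot all_order all_algebra.
From mathcomp Require Import all_classical all_reals all_analysis.

Set Implicit Arguments.
Unset Strict Implicit.
Unset Printing Implicit Defensive.

Import Order.TTheory GRing.Theory Num.Theory.
Local Open Scope classical_set_scope.
Local Open Scope ring_scope.

(* The library norm on matrices over a realType is the sup norm, so the
   Euclidean and Frobenius norms are defined here. *)
Definition dotp (R : realType) n (x y : 'cV[R]_n) : R :=
  \sum_(j < n) x j 0 * y j 0.

Definition norm2 (R : realType) n (x : 'cV[R]_n) : R := Num.sqrt (dotp x x).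

Definition norm1 (R : realType) n (x : 'cV[R]_n) : R := \sum_(j < n) `|x j 0|.

Definition normF (R : realType) m n (A : 'M[R]_(m, n)) : R :=
  Num.sqrt (\sum_(i < m) \sum_(j < n) A i j ^+ 2).

(* When n > m this set may contain 0 even if 0 is not among the min(m, n)
   singular values in the SVD; this affects neither the largest nor the
   smallest nonzero singular value. *)
Definition singular_values (R : realType) m n (A : 'M[R]_(m, n)) : set R :=
  [set s | 0 <= s /\ eigenvalue (A^T *m A) (s ^+ 2)].

(* In the definitions below, sup and inf range over finite sets, so that they
   are a maximum and a minimum as soon as these sets are nonempty. *)
Definition sigma_max (R : realType) m n (A : 'M[R]_(m, n)) : R :=
  sup (singular_values A).

Definition sigma_min (R : realType) m n (A : 'M[R]_(m, n)) : R :=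
  inf [set s | singular_values A s /\ s != 0].

Definition colsubset (R : realType) m n (A : 'M[R]_(m, n)) (J : {set 'I_n}) :
  'M[R]_(m, #|J|) := colsub (fun j : 'I_#|J| => enum_val j) A.

Definition sigma_min_tilde (R : realType) m n (A : 'M[R]_(m, n)) : R :=
  inf [set sigma_min (colsubset A J) | J in [set J | colsubset A J != 0]].

Definition abs_min (R : realType) n (x : 'cV[R]_n) : R :=
  inf [set `|x j 0| | j in [set j | x j 0 != 0]].

Definition sparse_obj (R : realType) n (lambda : R) (x : 'cV[R]_n) : R :=
  lambda * norm1 x + 2^-1 * norm2 x ^+ 2.

(* The Bregman distance $D_f^{x^*}(x,y)$; meaningful for x^* in the
   subdifferential of f at x. *)
Definition bregman (R : realType) n (f : 'cV[R]_n -> R) (xs x y : 'cV[R]_n) : R :=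
  f y - f x - dotp xs (y - x).

Definition soft_shrink (R : realType) n (lambda : R) (x : 'cV[R]_n) : 'cV[R]_n :=
  \col_j (Num.max (`|x j 0| - lambda) 0 * Num.sg (x j 0)).

Definition rowv (R : realType) m n (A : 'M[R]_(m, n)) (i : 'I_m) : 'cV[R]_n :=
  (row i A)^T.

(* [rska A b lambda w tau k] is the pair (x_k, x_k^* ), where [tau k j] is the
   j-th of the eta indices drawn at step k. *)
Fixpoint rska (R : realType) m n eta (A : 'M[R]_(m, n)) (b : 'cV[R]_m)
    (lambda : R) (w : 'I_m -> R) (tau : nat -> 'I_eta -> 'I_m) (k : nat) :
    'cV[R]_n * 'cV[R]_n :=
  if k is k'.+1 then
    let: (x, xs) := rska A b lambda w tau k' in
    let xs' := xs - eta%:R^-1 *: \sum_(j < eta)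
      let i := tau k' j in
      (w i * ((dotp (rowv A i) x - b i 0) / norm2 (rowv A i) ^+ 2)) *: rowv A i in
    (soft_shrink lambda xs', xs')
  else (0, 0).

(* All the indices drawn (within a batch and across iterations) are mutually
   independent random variables, each with distribution p. *)
Definition iid_sampling (R : realType) (d : measure_display)
    (T : measurableType d) (P : probability T R) m eta (p : 'I_m -> R)
    (tau : nat -> 'I_eta -> T -> 'I_m) : Prop :=
  [/\ forall k j (B : set 'I_m), measurable (tau k j @^-1` B),
      forall k j i, P (tau k j @^-1` [set i]) = (p i)%:E &
      forall (K : seq (nat * 'I_eta)) (B : nat * 'I_eta -> set 'I_m), uniq K ->
        P (\bigcap_(kj in [set` K]) (tau kj.1 kj.2 @^-1` B kj)) =
        (\prod_(kj <- K) P (tau kj.1 kj.2 @^-1` B kj))%E].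

(* Main.v *)
Require Import Defs.
From HB Require Import structures.
From mathcomp Require Import all_boot all_order all_algebra.
From mathcomp Require Import all_classical all_reals all_analysis.
From mathcomp Require Import measurable_realfun.
From mathcomp Require Import ring lra.

(* The Bregman distance to xhat decreases in mean: smoothness of the conjugate
   f^* = 1/2 |S_lambda|^2 bounds one step by a quadratic in the increment, and the
   first two moments of a batch turn this bound into a decrease by
   (L(alpha) / |A|_F^2) |A x_k - b|^2.  Linear convergence then follows from the
   error bound D(x, xhat) <= gamma |A x - b|^2, valid when x^* = A^T y.

   For the error bound, neither a dual solution nor Farkas' lemma is used.  With
   h(y) = f^*(A^T y) - <y, b>, let z minimize h + e/2 |. - y|^2 and put
   x_e = S_lambda(A^T z), d = y - z; then A x_e - b = e d, so d = A beta with
   beta = (x_e - xhat) / e, and x_e -> xhat as e -> 0.  For e small, x_e has one of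
   finitely many sign patterns, and this forces the part of beta supported on
   T = supp x_e to lie in the range of A_T^T, whence
   sigma_min_tilde(A) |beta| <= |d|.  Pairing with A^T d and using that shrinkage is
   strongly monotone, up to the factor |xhat|_min / (|xhat|_min + 2 lambda),
   bounds |d| by the residual; convexity of h and e -> 0 conclude. *)

Set Implicit Arguments.
Unset Strict Implicit.
Unset Printing Implicit Defensive.

Import Order.TTheory GRing.Theory Num.Theory.
Import numFieldNormedType.Exports.
Local Open Scope classical_set_scope.
Local Open Scope ring_scope.

(** * Euclidean geometry *)

Section InnerProduct.
Variables (R : realType) (n : nat).
Implicit Types (x y z : 'cV[R]_n) (a : R).

Lemma dotpE x y : dotp x y = (x^T *m y) 0 0.
Proof. by rewrite mxE; apply: eq_bigr => j _; rewrite mxE. Qed.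

Lemma dotpC x y : dotp x y = dotp y x.
Proof. by apply: eq_bigr => j _; rewrite mulrC. Qed.

Lemma dotpDl x y z : dotp (x + y) z = dotp x z + dotp y z.
Proof. by rewrite !dotpE linearD mulmxDl mxE. Qed.

Lemma dotpZl a x z : dotp (a *: x) z = a * dotp x z.
Proof. by rewrite !dotpE linearZ /= -scalemxAl mxE. Qed.

Lemma dotpNl x z : dotp (- x) z = - dotp x z.
Proof. by rewrite -scaleN1r dotpZl mulN1r. Qed.

Lemma dotpBl x y z : dotp (x - y) z = dotp x z - dotp y z.
Proof. by rewrite dotpDl dotpNl. Qed.

Lemma dotpDr x y z : dotp z (x + y) = dotp z x + dotp z y.
Proof. by rewrite dotpC dotpDl !(dotpC z). Qed.

Lemma dotpZr a x z : dotp z (a *: x) = a * dotp z x.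
Proof. by rewrite dotpC dotpZl (dotpC z). Qed.

Lemma dotpNr x z : dotp z (- x) = - dotp z x.
Proof. by rewrite dotpC dotpNl (dotpC z). Qed.

Lemma dotpBr x y z : dotp z (x - y) = dotp z x - dotp z y.
Proof. by rewrite dotpDr dotpNr. Qed.

Lemma dotp0l x : dotp 0 x = 0.
Proof. by rewrite -(scale0r 0) dotpZl mul0r. Qed.

Lemma dotp0r x : dotp x 0 = 0.
Proof. by rewrite dotpC dotp0l. Qed.

Lemma dotp_ge0 x : 0 <= dotp x x.
Proof. by apply: sumr_ge0 => j _; rewrite -expr2 sqr_ge0. Qed.

Lemma sqr_coord_le_dotp x j : x j 0 ^+ 2 <= dotp x x.
Proof.
rewrite /dotp (bigD1 j) //= -expr2 lerDl.
by apply: sumr_ge0 => i _; rewrite -expr2 sqr_ge0.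
Qed.

Lemma dotp_eq0 x : (dotp x x == 0) = (x == 0).
Proof.
apply/eqP/eqP => [x0|->]; last by rewrite dotp0l.
apply/matrixP => j i; rewrite ord1 mxE; apply/eqP.
by rewrite -sqrf_eq0 eq_le sqr_ge0 andbT -x0 sqr_coord_le_dotp.
Qed.

Lemma dotp_gt0 x : x != 0 -> 0 < dotp x x.
Proof. by move=> x0; rewrite lt_def dotp_eq0 x0 dotp_ge0. Qed.

Lemma norm2_ge0 x : 0 <= norm2 x.
Proof. exact: sqrtr_ge0. Qed.

Lemma sqr_norm2 x : norm2 x ^+ 2 = dotp x x.
Proof. by rewrite sqr_sqrtr // dotp_ge0. Qed.

Lemma dotpDD x y : dotp (x + y) (x + y) = dotp x x + 2 * dotp x y + dotp y y.
Proof. by rewrite !(dotpDl, dotpDr) (dotpC y x); ring. Qed.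

Lemma dotpBB x y : dotp (x - y) (x - y) = dotp x x - 2 * dotp x y + dotp y y.
Proof. by rewrite dotpDD dotpNr dotpNl dotpNr; ring. Qed.

Lemma CauchySchwarz x y : dotp x y ^+ 2 <= dotp x x * dotp y y.
Proof.
have [->|y0] := eqVneq y 0; first by rewrite !dotp0r expr0n mulr0.
have := dotp_ge0 (dotp y y *: x - dotp x y *: y).
rewrite dotpBB !(dotpZl, dotpZr) => h.
have yy := dotp_gt0 y0.
rewrite -subr_ge0 -(pmulr_rge0 _ yy); apply: le_trans h _.
by rewrite le_eqVlt; apply/orP; left; apply/eqP; ring.
Qed.

Lemma CauchySchwarz_norm2 x y : `|dotp x y| <= norm2 x * norm2 y.
Proof.
rewrite -(@ler_pXn2r _ 2) // ?nnegrE ?mulr_ge0 ?norm2_ge0 //.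
by rewrite real_normK ?num_real // exprMn !sqr_norm2 CauchySchwarz.
Qed.

Lemma norm2_gt0 x : x != 0 -> 0 < norm2 x.
Proof. by move=> x0; rewrite sqrtr_gt0 dotp_gt0. Qed.

Lemma coord_le_norm2 x j : `|x j 0| <= norm2 x.
Proof.
rewrite -(@ler_pXn2r _ 2) // ?nnegrE ?norm2_ge0 // sqr_norm2.
by rewrite real_normK ?num_real // sqr_coord_le_dotp.
Qed.

End InnerProduct.

Lemma dotp_mull (R : realType) m n (A : 'M[R]_(m, n)) (x : 'cV[R]_n)
  (y : 'cV[R]_m) : dotp (A *m x) y = dotp x (A^T *m y).
Proof. by rewrite !dotpE trmx_mul mulmxA. Qed.

Lemma dotp_mulr (R : realType) m n (A : 'M[R]_(m, n)) (x : 'cV[R]_n)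
  (y : 'cV[R]_m) : dotp y (A *m x) = dotp (A^T *m y) x.
Proof. by rewrite dotpC dotp_mull dotpC. Qed.

Lemma normF_ge0 (R : realType) m n (A : 'M[R]_(m, n)) : 0 <= normF A.
Proof. exact: sqrtr_ge0. Qed.

Lemma sqr_normF (R : realType) m n (A : 'M[R]_(m, n)) :
  normF A ^+ 2 = \sum_(i < m) dotp (rowv A i) (rowv A i).
Proof.
rewrite sqr_sqrtr; last first.
  by apply: sumr_ge0 => i _; apply: sumr_ge0 => j _; rewrite sqr_ge0.
by apply: eq_bigr => i _; apply: eq_bigr => j _; rewrite !mxE expr2.
Qed.

Lemma mulmx_rowv (R : realType) m n (A : 'M[R]_(m, n)) (x : 'cV[R]_n) i :
  (A *m x) i 0 = dotp (rowv A i) x.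
Proof. by rewrite mxE; apply: eq_bigr => j _; rewrite !mxE. Qed.

Lemma dotp_mulmx_le (R : realType) m n (A : 'M[R]_(m, n)) (x : 'cV[R]_n) :
  dotp (A *m x) (A *m x) <= normF A ^+ 2 * dotp x x.
Proof.
rewrite sqr_normF mulr_suml; apply: ler_sum => i _.
by rewrite -expr2 mulmx_rowv CauchySchwarz.
Qed.

(** * Soft shrinkage and the conjugate objective *)

Section Shrinkage.
Variables (R : realType) (lambda : R).
Hypothesis lambda_ge0 : 0 <= lambda.

Definition shrink (z : R) : R := Num.max (`|z| - lambda) 0 * Num.sg z.

Variant shrink_spec (z : R) : R -> Type :=
| ShrinkPos of lambda < z : shrink_spec z (z - lambda)
| ShrinkNeg of z < - lambda : shrink_spec z (z + lambda)
| ShrinkZero of - lambda <= z & z <= lambda : shrink_spec z 0.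

Lemma shrinkP z : shrink_spec z (shrink z).
Proof.
have l0 := lambda_ge0.
rewrite /shrink; have [zl|zl] := lerP `|z| lambda.
  have -> : Num.max (`|z| - lambda) 0 = 0 by apply/max_idPr; rewrite subr_le0.
  by rewrite mul0r; move: zl; rewrite ler_norml => /andP[]; constructor.
have -> : Num.max (`|z| - lambda) 0 = `|z| - lambda.
  by apply/max_idPl; rewrite subr_ge0 ltW.
have [z0|z0|z0] := ltrgt0P z.
- by rewrite gtr0_sg // mulr1; constructor; rewrite gtr0_norm in zl.
- rewrite ltr0_sg // ltr0_norm // in zl *.
  have -> : (- z - lambda) * -1 = z + lambda by ring.
  by constructor; lra.
- by move: zl; rewrite z0 normr0 ltNge lambda_ge0.
Qed.

(** Together with [shrink_fenchel], this makes [z - shrink z] a subgradient of [lambda * |.|] at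
    [shrink z]. *)
Lemma norm_sub_shrink z : `|z - shrink z| <= lambda.
Proof.
have l0 := lambda_ge0.
by case: shrinkP => *; rewrite ler_norml; apply/andP; split; lra.
Qed.

Lemma shrink_fenchel z : (z - shrink z) * shrink z = lambda * `|shrink z|.
Proof.
have l0 := lambda_ge0.
case: shrinkP => h; last by rewrite !(normr0, mulr0).
- by rewrite ger0_norm; [ring|lra].
- by rewrite ler0_norm; [ring|lra].
Qed.

Lemma mul_sub_shrink_le z y : (z - shrink z) * y <= lambda * `|y|.
Proof.
apply: le_trans (ler_norm _) _; rewrite normrM.
by rewrite ler_wpM2r // norm_sub_shrink.
Qed.

Lemma shrink_neq0 z : shrink z != 0 -> z = shrink z + lambda * Num.sg (shrink z).
Proof.
have l0 := lambda_ge0.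
case: shrinkP => [zl|zl|? ?]; last by rewrite eqxx.
- by move=> _; rewrite gtr0_sg; [ring|lra].
- by move=> _; rewrite ltr0_sg; [ring|lra].
Qed.

(** Adding the subgradient inequalities at [shrink z] and [shrink z'] even gives the lower bound
    [(shrink z - shrink z')^2]. *)
Lemma shrink_mono z z' : 0 <= (z - z') * (shrink z - shrink z').
Proof.
have h1 := shrink_fenchel z; have h2 := shrink_fenchel z'.
have h3 := mul_sub_shrink_le z (shrink z').
have h4 := mul_sub_shrink_le z' (shrink z).
have := sqr_ge0 (shrink z - shrink z').
by nra.
Qed.

(** Moving from [z'] away from zero stays on one affine piece, of slope 1. *)
Lemma shrink_same_sign z z' : shrink z' != 0 -> 0 <= (z - z') * shrink z' ->
  shrink z - shrink z' = z - z'.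
Proof.
have l0 := lambda_ge0.
case: (shrinkP z') => [h'|h'|? ?] s'0 h; last by rewrite eqxx in s'0.
- have {}h : 0 <= z - z' by move: h; rewrite pmulr_lge0 //; lra.
  by case: shrinkP => ?; lra.
- have {}h : z - z' <= 0 by move: h; rewrite nmulr_lge0 //; lra.
  by case: shrinkP => ?; lra.
Qed.

(** The secant slope of [shrink] from [z'] is least when [z] is at the far end of the dead zone,
    [z = - lambda * sg z']. There [shrink z = 0], and the slope is the ratio of the two factors. *)
Lemma shrink_restricted_strong_mono z z' : shrink z' != 0 ->
  `|shrink z'| * (z - z') ^+ 2 <=
  (`|shrink z'| + 2 * lambda) * ((z - z') * (shrink z - shrink z')).
Proof.
have l0 := lambda_ge0.
case: (shrinkP z') => [h'|h'|? ?] s'0; last by rewrite eqxx in s'0.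
- rewrite gtr0_norm; last lra.
  (* In each case, here and for negative [z'], the right side minus the left is the displayed
     product or twice it. *)
  case: (shrinkP z) => [h|h|h1 h2]; rewrite -subr_ge0.
  + by have : 0 <= lambda * (z - z') ^+ 2 := mulr_ge0 l0 (sqr_ge0 _); nra.
  + have : 0 <= lambda * ((z' - z) * (- lambda - z)).
      by rewrite !mulr_ge0 //; lra.
    by nra.
  + have : 0 <= (z' - lambda) * ((z' - z) * (z + lambda)).
      by rewrite !mulr_ge0 //; lra.
    by nra.
- rewrite ltr0_norm; last lra.
  case: (shrinkP z) => [h|h|h1 h2]; rewrite -subr_ge0.
  + have : 0 <= lambda * ((z - z') * (z - lambda)).
      by rewrite !mulr_ge0 //; lra.
    by nra.
  + by have : 0 <= lambda * (z - z') ^+ 2 := mulr_ge0 l0 (sqr_ge0 _); nra.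
  + have : 0 <= (- z' - lambda) * ((z - z') * (lambda - z)).
      by rewrite !mulr_ge0 //; lra.
    by nra.
Qed.

End Shrinkage.

Section SoftShrink.
Variables (R : realType) (n : nat) (lambda : R).
Hypothesis lambda_ge0 : 0 <= lambda.
Implicit Types x y z : 'cV[R]_n.
Local Notation S := (soft_shrink lambda).
Local Notation f := (sparse_obj lambda).

Lemma soft_shrinkE z j : S z j 0 = shrink lambda (z j 0).
Proof. by rewrite mxE. Qed.

Lemma soft_shrink0 : S 0 = 0 :> 'cV[R]_n.
Proof. by apply/matrixP => j i; rewrite !mxE sgr0 mulr0. Qed.

Lemma norm1_ge0 x : 0 <= norm1 x.
Proof. exact: sumr_ge0. Qed.

Lemma sparse_obj_ge x : 2^-1 * dotp x x <= f x.
Proof. by rewrite /sparse_obj sqr_norm2 lerDr mulr_ge0 ?norm1_ge0. Qed.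

Lemma dotp_soft_shrink_fenchel z :
  dotp z (S z) = lambda * norm1 (S z) + dotp (S z) (S z).
Proof.
rewrite /dotp /norm1 mulr_sumr -big_split; apply: eq_bigr => j _ /=.
by rewrite soft_shrinkE -shrink_fenchel //; ring.
Qed.

Lemma dotp_sub_soft_shrink_le z y :
  dotp z y <= dotp (S z) y + lambda * norm1 y.
Proof.
rewrite /dotp /norm1 mulr_sumr -big_split; apply: ler_sum => j _ /=.
rewrite soft_shrinkE -lerBlDl.
apply: le_trans (mul_sub_shrink_le lambda_ge0 (z j 0) _).
by rewrite le_eqVlt; apply/orP; left; apply/eqP; ring.
Qed.

(** Fenchel's equality [f (S z) + 1/2 |S z|^2 = <z, S z>] turns the distance into a Fenchel gap, in
    which the conjugate of [f] appears as [1/2 |S z|^2]. *)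
Lemma bregman_soft_shrink z y :
  bregman f z (S z) y = f y + 2^-1 * dotp (S z) (S z) - dotp z y.
Proof.
by rewrite /bregman dotpBr dotp_soft_shrink_fenchel /sparse_obj !sqr_norm2; lra.
Qed.

(** [f] is 1-strongly convex and [z] is a subgradient of it at [S z]. *)
Lemma bregman_soft_shrink_ge z y :
  2^-1 * dotp (y - S z) (y - S z) <= bregman f z (S z) y.
Proof.
rewrite bregman_soft_shrink dotpBB (dotpC y) /sparse_obj sqr_norm2.
by have := dotp_sub_soft_shrink_le z y; lra.
Qed.

(** The gradient [S] of the conjugate is 1-Lipschitz. Here the bound comes from
    [|S z + (z' - z) - S z'|^2 >= 0] and from pairing the subgradient [z - S z] with [S z']. *)
Lemma soft_shrink_conj_smooth z z' :
  2^-1 * dotp (S z') (S z') <=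
  2^-1 * dotp (S z) (S z) + dotp (S z) (z' - z) + 2^-1 * dotp (z' - z) (z' - z).
Proof.
have h1 := dotp_soft_shrink_fenchel z'.
have h2 := dotp_sub_soft_shrink_le z (S z').
have := dotp_ge0 (S z + (z' - z) - S z').
have e : dotp z' (S z') = dotp z (S z') + dotp (z' - z) (S z').
  by rewrite dotpBl; ring.
by rewrite dotpBB dotpDD !(dotpDl (S z)); lra.
Qed.

Lemma soft_shrink_conj_convex z z' :
  2^-1 * dotp (S z) (S z) + dotp (S z) (z' - z) <= 2^-1 * dotp (S z') (S z').
Proof.
have h1 := dotp_soft_shrink_fenchel z.
have h2 := dotp_sub_soft_shrink_le z' (S z).
have := dotp_ge0 (S z - S z').
by rewrite dotpBB !dotpBr !(dotpC _ z') !(dotpC _ z) (dotpC _ (S z')); lra.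
Qed.

Lemma bregman_step_le z z' y : bregman f z' (S z') y <=
  bregman f z (S z) y + dotp (z' - z) (S z - y) + 2^-1 * dotp (z' - z) (z' - z).
Proof.
rewrite !bregman_soft_shrink; have := soft_shrink_conj_smooth z z'.
by rewrite (dotpC (S z)) !(dotpBl, dotpBr); lra.
Qed.

End SoftShrink.

(** * Extremal singular values *)

Lemma trmx_continuous (R : realType) m n :
  continuous (@trmx R m n).
Proof.
move=> M s /= /nbhs_ballP[e e0 es]; apply/nbhs_ballP; exists e => //= N [_ MN].
by apply: es; split => // i j; rewrite !mxE; exact: MN.
Qed.

(** Transposition moves the problem to row vectors. There [sqrt B] bounds every coordinate, hence
    the sup norm, and the closed set is compact. *)
Lemma EVT_min_cV (R : realType) n (F : 'cV[R]_n -> R) (C : set 'cV[R]_n) (B : R) :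
  continuous F -> closed C -> C !=set0 -> (forall v, C v -> dotp v v <= B) ->
  exists2 c, C c & forall v, C v -> F c <= F v.
Proof.
move=> cF clC [v0 Cv0] bC.
pose T : 'rV[R]_n -> 'cV[R]_n := trmx.
have cT : continuous T by exact: trmx_continuous.
have compactC : compact (T @^-1` C).
  apply: bounded_closed_compact; last first.
    by apply: preimage_closed => // x _; exact: cT.
  exists (Num.sqrt B); split; first exact: num_real.
  move=> M BM v /bC Cv; rewrite /Num.norm /= mx_normrE.
  apply: bigmax_le; first by rewrite (le_trans (sqrtr_ge0 B)) ?ltW.
  move=> [i j] _ /=; rewrite ord1; apply: le_trans (ltW BM).
  have := coord_le_norm2 (T v) j; rewrite mxE => /le_trans; apply.
  by rewrite ler_sqrt ?(le_trans (dotp_ge0 _) Cv).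
have [||c] := @EVT_min_rV R n (F \o T) (T @^-1` C) _ compactC.
- by exists v0^T; rewrite /T /= trmxK.
- apply: continuous_subspaceT => x.
  by apply: continuous_comp; [exact: cT|exact: cF].
rewrite inE => Cc minc; exists (T c) => // v Cv.
by have := minc v^T; rewrite inE /T /= trmxK; exact.
Qed.

Lemma continuous_coord_sum (R : realType) n k (F : 'I_k -> 'cV[R]_n -> R) :
  (forall i, continuous (F i)) -> continuous (fun v => \sum_(i < k) F i v).
Proof.
by move=> cF; apply: continuous_big => //; exact: add_continuous.
Qed.

Lemma mulmx_coord_continuous (R : realType) m n (A : 'M[R]_(m, n)) i :
  continuous (fun v : 'cV[R]_n => (A *m v) i 0).
Proof.
have -> : (fun v : 'cV[R]_n => (A *m v) i 0) = fun v => \sum_j A i j * v j 0.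
  by apply/funext => v; rewrite mxE.
apply: (@continuous_coord_sum _ _ _ (fun j v => A i j * v j 0)) => j v.
apply: (@continuousM _ _ (fun=> A i j)); first exact: cst_continuous.
exact: coord_continuous.
Qed.

Lemma dotp_mulmx_continuous (R : realType) m n (A B : 'M[R]_(m, n)) :
  continuous (fun v : 'cV[R]_n => dotp (A *m v) (B *m v)).
Proof.
apply: (@continuous_coord_sum _ _ _
  (fun i v => (A *m v) i 0 * (B *m v) i 0)) => i v.
by apply: continuousM; exact: mulmx_coord_continuous.
Qed.

Lemma dotp_continuous (R : realType) n : continuous (fun v : 'cV[R]_n => dotp v v).
Proof.
have -> : (fun v : 'cV[R]_n => dotp v v) =
          fun v => dotp (1%:M *m v) (1%:M *m v).
  by apply/funext => v; rewrite mul1mx.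
exact: dotp_mulmx_continuous.
Qed.

Lemma quadratic_ge0_lin0 (R : realType) (a c : R) :
  (forall t, 0 <= t * a + t ^+ 2 * c) -> a = 0.
Proof.
move=> h; have s0 : 0 < 1 + `|c| by rewrite ltr_wpDr.
(* At this [t] the expression, times [(1 + |c|)^2], equals [a^2 (c - |c| - 1)], which is at most
   [- a^2]. *)
have := h (- a / (1 + `|c|)).
rewrite -(pmulr_rge0 _ (exprn_gt0 2 s0)).
have -> : (1 + `|c|) ^+ 2 * (- a / (1 + `|c|) * a + (- a / (1 + `|c|)) ^+ 2 * c)
  = a ^+ 2 * (c - `|c| - 1) by field; rewrite gt_eqF.
move=> h1; apply/eqP; rewrite -sqrf_eq0 eq_le sqr_ge0 andbT.
by have := ler_norm c; have := sqr_ge0 a; nra.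
Qed.

(** By compactness the Rayleigh quotient attains its minimum [mu] on the unit sphere of [ker K], at
    some [v]. The vector [w = G v - mu v] also lies in [ker K], so the first variation along [w],
    which is [2 |w|^2], vanishes. [K = 0] serves for the largest singular value, the transpose of
    [cokermx A] for the smallest nonzero one. *)
Lemma rayleigh_min (R : realType) n l (G : 'M[R]_n) (K : 'M[R]_(l, n)) :
  G^T = G -> (forall v : 'cV_n, K *m v = 0 -> K *m (G *m v) = 0) ->
  (exists2 v : 'cV_n, v != 0 & K *m v = 0) ->
  exists (mu : R) (v : 'cV_n), [/\ v != 0, K *m v = 0, G *m v = mu *: v &
    forall u : 'cV_n, K *m u = 0 -> mu * dotp u u <= dotp u (G *m u)].
Proof.
move=> symG invK [v0 v00 Kv0].
pose C := [set v : 'cV[R]_n | dotp v v = 1] `&`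
          [set v : 'cV[R]_n | dotp (K *m v) (K *m v) = 0].
have normC (u : 'cV[R]_n) : u != 0 -> K *m u = 0 -> C ((norm2 u)^-1 *: u).
  move=> u0 Ku; split => /=; last by rewrite -scalemxAr Ku scaler0 dotp0r.
  rewrite dotpZl dotpZr -sqr_norm2; have := norm2_gt0 u0 => /gt_eqF/negbT ?.
  by field.
have clC : closed C.
  apply: closedI.
  - apply: (@preimage_closed _ _ (fun v : 'cV[R]_n => dotp v v) [set 1]) => //.
    by move=> x _; exact: dotp_continuous.
  - apply: (@preimage_closed _ _
      (fun v : 'cV[R]_n => dotp (K *m v) (K *m v)) [set 0]) => //.
    by move=> x _; exact: dotp_mulmx_continuous.
have cF : continuous (fun v : 'cV[R]_n => dotp v (G *m v)).
  have -> : (fun v : 'cV[R]_n => dotp v (G *m v)) =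
            fun v => dotp (1%:M *m v) (G *m v).
    by apply/funext => v; rewrite mul1mx.
  exact: dotp_mulmx_continuous.
have [|v [/= v1 /eqP]] :=
  EVT_min_cV (B := 1) cF clC (ex_intro _ _ (normC _ v00 Kv0)).
  by move=> v [/= -> _].
rewrite dotp_eq0 => /eqP Kv minv.
pose mu := dotp v (G *m v); exists mu, v.
have min_mu u : K *m u = 0 -> mu * dotp u u <= dotp u (G *m u).
  move=> Ku; have [->|u0] := eqVneq u 0; first by rewrite mulmx0 !dotp0r mulr0.
  have := minv _ (normC u u0 Ku).
  rewrite -scalemxAr dotpZl dotpZr -/mu -sqr_norm2 mulrA -expr2 exprVn mulrC.
  by rewrite ler_pdivlMr ?exprn_gt0 // norm2_gt0.
split => //.
  by apply: contra_eq_neq v1 => ->; rewrite dotp0r eq_sym oner_eq0.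
pose w := G *m v - mu *: v.
have Kw : K *m w = 0 by rewrite mulmxBr invK // -scalemxAr Kv scaler0 subr0.
have symD x y : dotp x (G *m y) = dotp y (G *m x).
  by rewrite dotp_mulr symG dotpC.
suff : dotp w w = 0 by move/eqP; rewrite dotp_eq0 subr_eq0 => /eqP.
have ww : dotp w w = dotp w (G *m v) - mu * dotp w v.
  by rewrite {2}/w dotpBr dotpZr.
clearbody w.
suff /eqP : 2 * dotp w w = 0 by rewrite mulf_eq0 pnatr_eq0 /= => /eqP.
apply: (@quadratic_ge0_lin0 _ _ (dotp w (G *m w) - mu * dotp w w)) => t.
have := min_mu (v + t *: w).
rewrite mulmxDr -scalemxAr Kv Kw scaler0 addr0 => /(_ erefl).
rewrite dotpDD mulmxDr -scalemxAr !(dotpDl, dotpDr, dotpZl, dotpZr) v1 (symD v w).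
rewrite -/mu (dotpC v w); move: ww; set a := dotp w w; set b := dotp w (G *m v).
by set c := dotp w v; set e := dotp w (G *m w) => ->; lra.
Qed.

(** Applied to a characteristic polynomial, this leaves finitely many singular values, so that the
    infimum of the nonzero ones is positive. *)
Lemma poly_roots_seq (F : fieldType) (p : {poly F}) : p != 0 ->
  exists r : seq F, forall x, root p x -> x \in r.
Proof.
have [N] := ubnP (size p); elim: N p => // N IHN p pN p0.
have [[x px]|nr] := pselect (exists x, root p x); last first.
  by exists [::] => x px; case: nr; exists x.
have [q pq] := factor_theorem _ _ px.
have q0 : q != 0 by apply: contra_neq p0 => q0; rewrite pq q0 mul0r.
have [|r rP] := IHN q _ q0.
  apply: leq_trans (pN : (size p <= N)%N).
  by rewrite pq size_Mmonic ?monicXsubC // size_XsubC addn2.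
exists (x :: r) => y; rewrite pq rootM root_XsubC inE orbC.
by case/orP => [->|/rP ->]; rewrite ?orbT.
Qed.

Section SingularValues.
Variables (R : realType) (m n : nat) (A : 'M[R]_(m, n)).

Lemma singular_valuesP s : singular_values A s <->
  0 <= s /\ exists2 v : 'cV_n, v != 0 & A^T *m (A *m v) = s ^+ 2 *: v.
Proof.
have symG : (A^T *m A)^T = A^T *m A by rewrite trmx_mul trmxK.
split => -[s0]; last first.
  move=> [v v0 Av]; split => //; apply/eigenvalueP; exists v^T.
    by rewrite -symG -trmx_mul -mulmxA Av linearZ.
  by apply: contra_neq v0 => v0; rewrite -[v]trmxK v0 linear0.
move=> /eigenvalueP[v Av v0]; split => //; exists v^T.
  by apply: contra_neq v0 => v0; rewrite -[v]trmxK v0 linear0.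
by rewrite mulmxA -[A^T *m A]symG -trmx_mul Av linearZ.
Qed.

Lemma singular_values_norm s : singular_values A s ->
  exists2 v : 'cV_n, v != 0 & dotp (A *m v) (A *m v) = s ^+ 2 * dotp v v.
Proof.
move=> /singular_valuesP[_ [v v0 Av]]; exists v => //.
by rewrite dotp_mull Av dotpZr.
Qed.

Lemma singular_values_le_normF s : singular_values A s -> s <= normF A.
Proof.
move=> sA; have [v v0 sv] := singular_values_norm sA; have [s0 _] := sA.
rewrite -(@ler_pXn2r _ 2) // ?nnegrE ?normF_ge0 //.
by rewrite -(ler_pM2r (dotp_gt0 v0)) -sv dotp_mulmx_le.
Qed.

Lemma singular_values_has_ubound : has_ubound (singular_values A).
Proof. by exists (normF A) => s; exact: singular_values_le_normF. Qed.

(** Minus the least eigenvalue of [- A^T A] is the square of the largest singular value. *)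
Lemma max_singular_value : (0 < n)%N ->
  exists2 s, singular_values A s &
    forall v : 'cV_n, dotp (A *m v) (A *m v) <= s ^+ 2 * dotp v v.
Proof.
move=> n0; have [|||mu [v [v0 _ Gv maxv]]] :=
  @rayleigh_min R n 1 (- (A^T *m A)) 0.
- by rewrite linearN /= trmx_mul trmxK.
- by move=> v _; rewrite mul0mx.
- exists (const_mx 1); last by rewrite mul0mx.
  apply/eqP => /matrixP/(_ (Ordinal n0) 0); rewrite !mxE => /eqP.
  by rewrite oner_eq0.
have muE : dotp (A *m v) (A *m v) = - mu * dotp v v.
  by rewrite dotp_mull mulmxA -[A^T *m A]opprK mulNmx Gv dotpNr dotpZr mulNr.
have mu0 : 0 <= - mu.
  by rewrite -(pmulr_lge0 _ (dotp_gt0 v0)) -muE dotp_ge0.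
exists (Num.sqrt (- mu)).
  apply/singular_valuesP; split; first exact: sqrtr_ge0.
  exists v => //; rewrite sqr_sqrtr // scaleNr -Gv mulNmx opprK.
  by rewrite mulmxA.
move=> u; have := maxv u (mul0mx _ _).
by rewrite sqr_sqrtr // mulNmx dotpNr -mulmxA -dotp_mull; lra.
Qed.

Lemma dotp_le_sigma_max (v : 'cV_n) :
  dotp (A *m v) (A *m v) <= sigma_max A ^+ 2 * dotp v v.
Proof.
have [->|v0] := eqVneq v 0; first by rewrite mulmx0 !dotp0r mulr0.
have n0 : (0 < n)%N by case: (n) v v0 => // v; rewrite (flatmx0 v) eqxx.
have [s sA sP] := max_singular_value n0; apply: le_trans (sP v) _.
have [s0 _] := sA; have ssup := ub_le_sup singular_values_has_ubound sA.
rewrite ler_wpM2r ?dotp_ge0 // ler_pXn2r // nnegrE //.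
exact: le_trans ssup.
Qed.

Lemma sigma_max_ge0 : 0 <= sigma_max A.
Proof.
have [[s sA]|nA] := pselect (singular_values A !=set0).
  by apply: le_trans (ub_le_sup singular_values_has_ubound sA); case: sA.
by rewrite /sigma_max; have /set0P/negP/negPn/eqP -> := nA; rewrite sup0.
Qed.

Lemma sigma_max_le_normF : sigma_max A <= normF A.
Proof.
have [nA|nA] := pselect (singular_values A !=set0).
  exact/(ge_sup nA)/singular_values_le_normF.
by rewrite /sigma_max; have /set0P/negP/negPn/eqP -> := nA; rewrite sup0 normF_ge0.
Qed.

Local Notation nonzero_singular_values :=
  [set s | singular_values A s /\ s != 0].

Lemma nonzero_singular_values_has_lbound : has_lbound nonzero_singular_values.
Proof. by exists 0 => s [[]]. Qed.

Lemma sigma_min_ge0 : 0 <= sigma_min A.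
Proof.
have [ne|ne] := pselect (nonzero_singular_values !=set0).
  by apply: lb_le_inf => // s [[]].
by rewrite /sigma_min; have /set0P/negP/negPn/eqP -> := ne; rewrite inf0.
Qed.

Lemma nonzero_singular_value : A != 0 -> nonzero_singular_values !=set0.
Proof.
move=> A0; have n0 : (0 < n)%N.
  by case: (n) (A) A0 => // B; rewrite (thinmx0 B) eqxx.
have [s sA sP] := max_singular_value n0; exists s; split => //.
apply: contra_neq A0 => s0; apply/matrixP => i j.
have Aj0 : A *m delta_mx j 0 == 0 :> 'cV_m.
  rewrite -dotp_eq0 eq_le dotp_ge0 andbT.
  by have := sP (delta_mx j 0); rewrite s0 expr0n mul0r.
by move/eqP: Aj0; rewrite -colE => /matrixP/(_ i 0); rewrite !mxE.
Qed.

Lemma sigma_min_gt0 : A != 0 -> 0 < sigma_min A.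
Proof.
move=> /nonzero_singular_value ne.
have [r rP] := poly_roots_seq (monic_neq0 (char_poly_monic (A^T *m A))).
(* A finite minimum of positive numbers, with default 1, is a positive lower bound. *)
pose e := \big[Num.min/1]_(x <- r | 0 < x) Num.sqrt x.
have e0 : 0 < e.
  by apply: lt_bigmin => // x x0; rewrite sqrtr_gt0.
apply: lt_le_trans e0 _; apply: lb_le_inf => // s [[s0 sA] sn0].
have sr : s ^+ 2 \in r by apply: rP; rewrite -eigenvalue_root_char.
have -> : s = Num.sqrt (s ^+ 2) by rewrite sqrtr_sqr ger0_norm.
by apply: ge_bigmin_seq => //; rewrite exprn_gt0 // lt_def sn0.
Qed.

(** The range of [A^T] is [ker K], with [K] the transpose of [cokermx A]. There [A^T A] is positive
    definite, so its least eigenvalue is the square of a nonzero singular value. *)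
Lemma sigma_min_range (y : 'cV_m) :
  sigma_min A ^+ 2 * dotp (A^T *m y) (A^T *m y) <=
  dotp (A *m (A^T *m y)) (A *m (A^T *m y)).
Proof.
have [->|v0] := eqVneq (A^T *m y) 0; first by rewrite mulmx0 !dotp0r mulr0.
pose K := (cokermx A)^T.
have KP (v : 'cV_n) : K *m v = 0 <-> exists u : 'cV_m, v = A^T *m u.
  split=> [Kv|[u ->]]; last first.
    by rewrite mulmxA -trmx_mul mulmx_coker trmx0 mul0mx.
  have : (v^T <= A)%MS by rewrite submxE -[v^T *m _]trmxK trmx_mul trmxK Kv trmx0.
  by move=> /submxP[u uA]; exists u^T; rewrite -trmx_mul -uA trmxK.
have [|||mu [v [vn0 /KP[u vu] Gv minv]]] :=
  @rayleigh_min R n n (A^T *m A) K.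
- by rewrite trmx_mul trmxK.
- by move=> v _; apply/KP; exists (A *m v); rewrite mulmxA.
- by exists (A^T *m y) => //; apply/KP; exists y.
have muE : dotp (A *m v) (A *m v) = mu * dotp v v.
  by rewrite dotp_mull mulmxA Gv dotpZr.
have mu0 : 0 < mu.
  rewrite -(pmulr_lgt0 _ (dotp_gt0 vn0)) -muE dotp_gt0 //.
  apply: contra_neq vn0 => Av0; apply/eqP.
  by rewrite -dotp_eq0 {2}vu dotp_mulr trmxK Av0 dotp0l.
have smu : nonzero_singular_values (Num.sqrt mu).
  split; last by rewrite gt_eqF // sqrtr_gt0.
  apply/singular_valuesP; split; first exact: sqrtr_ge0.
  by exists v => //; rewrite mulmxA sqr_sqrtr // ltW.
have le_mu : sigma_min A ^+ 2 <= mu.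
  rewrite -[leRHS](sqr_sqrtr (ltW mu0)).
  rewrite ler_pXn2r // ?nnegrE ?sqrtr_ge0 ?sigma_min_ge0 //.
  exact: ge_inf nonzero_singular_values_has_lbound _ smu.
have /minv : K *m (A^T *m y) = 0 by apply/KP; exists y.
rewrite -mulmxA (dotp_mull A (A^T *m y)); move/(le_trans _); apply.
by rewrite ler_wpM2r ?dotp_ge0.
Qed.

End SingularValues.

Lemma sum_enum_val (V : nmodType) n (J : {set 'I_n}) (F : 'I_n -> V) :
  (forall j, j \notin J -> F j = 0) ->
  \sum_j F j = \sum_(k < #|J|) F (enum_val k).
Proof.
move=> F0; rewrite -(big_enum_val F) [LHS](bigID (mem J)) /=.
by rewrite [X in _ + X]big1 ?addr0.
Qed.

(** * Column submatrices and the constants of gamma *)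

Section ColumnSubsets.
Variables (R : realType) (m n : nat) (A : 'M[R]_(m, n)).
Implicit Type J : {set 'I_n}.

Lemma colsubset_setT_neq0 : A != 0 -> colsubset A [set: 'I_n] != 0.
Proof.
apply: contra_neq => C0; apply/matrixP => i j.
have /matrixP/(_ i (enum_rank_in (finset.in_setT j) j)) := C0.
by rewrite !mxE enum_rankK_in // finset.in_setT.
Qed.

Local Notation minima :=
  ([set sigma_min (colsubset A J) | J in [set J | colsubset A J != 0]]).

Lemma sigma_min_tilde_le J : colsubset A J != 0 ->
  sigma_min_tilde A <= sigma_min (colsubset A J).
Proof.
move=> AJ0; apply: ge_inf; last by exists J.
by exists 0 => _ [K _ <-]; exact: sigma_min_ge0.
Qed.

Lemma sigma_min_tilde_ge0 : 0 <= sigma_min_tilde A.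
Proof.
have [ne|ne] := pselect (minima !=set0).
  by apply: lb_le_inf => // _ [J _ <-]; exact: sigma_min_ge0.
by rewrite /sigma_min_tilde; have /set0P/negP/negPn/eqP -> := ne; rewrite inf0.
Qed.

Lemma sigma_min_tilde_gt0 : A != 0 -> 0 < sigma_min_tilde A.
Proof.
move=> /colsubset_setT_neq0 AT0.
pose e := \big[Num.min/1]_(J : {set 'I_n} | colsubset A J != 0)
  sigma_min (colsubset A J).
have e0 : 0 < e by apply: lt_bigmin => // J; exact: sigma_min_gt0.
apply: lt_le_trans e0 _; apply: lb_le_inf.
  by exists (sigma_min (colsubset A finset.setT)); exists finset.setT.
by move=> _ [J AJ0 <-]; exact: bigmin_le_cond.
Qed.

(** The entries of [v] on [J] form [C^T y] with [C = colsubset A J], so [sigma_min_range] applies to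
    [C]. *)
Lemma sigma_min_tilde_restrict J (y : 'cV_m) (v : 'cV_n) : A != 0 ->
  (forall j, j \notin J -> v j 0 = 0) ->
  (forall j, j \in J -> v j 0 = (A^T *m y) j 0) ->
  sigma_min_tilde A ^+ 2 * dotp v v <= dotp (A *m v) (A *m v).
Proof.
move=> A0 vJ vA; pose C := colsubset A J; pose w := C^T *m y.
have wE k : w k 0 = v (enum_val k) 0.
  rewrite vA ?enum_valP // !mxE.
  by apply: eq_bigr => i _; rewrite !mxE.
have CwE : C *m w = A *m v.
  apply/matrixP => i k; rewrite ord1 !mxE.
  rewrite (@sum_enum_val _ _ J (fun j => A i j * v j 0)); last first.
    by move=> j /vJ ->; rewrite mulr0.
  by apply: eq_bigr => l _; rewrite wE mxE.
have wwE : dotp w w = dotp v v.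
  rewrite /dotp [RHS](@sum_enum_val _ _ J); last first.
    by move=> j /vJ ->; rewrite mulr0.
  by apply: eq_bigr => l _; rewrite wE.
rewrite -CwE -wwE; have [C0|C0] := eqVneq C 0.
  by rewrite /w C0 trmx0 !mul0mx !dotp0r mulr0.
apply: le_trans (sigma_min_range C y); rewrite ler_wpM2r ?dotp_ge0 //.
rewrite ler_pXn2r // ?nnegrE ?sigma_min_ge0 ?sigma_min_tilde_ge0 //.
exact: sigma_min_tilde_le.
Qed.

(** Taking all columns, compare the lower and the upper bound on [|A v|^2] at a nonzero
    [v = A^T y]. *)
Lemma sigma_min_tilde_le_max : A != 0 -> sigma_min_tilde A <= sigma_max A.
Proof.
move=> A0; have [y Ay0] : exists y : 'cV_m, A^T *m y != 0.
  apply: contrapT => nA; case/eqP: A0; apply/matrixP => i j; rewrite mxE.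
  have /eqP : A^T *m delta_mx i 0 == 0 :> 'cV_n.
    by apply: contrapT => /negP ?; apply: nA; exists (delta_mx i 0).
  by rewrite -colE => /matrixP/(_ j 0); rewrite !mxE.
have := @sigma_min_tilde_restrict finset.setT y (A^T *m y) A0.
move=> /(_ _ (fun _ _ => erefl)) le1.
have {}le1 := le_trans (le1 _) (dotp_le_sigma_max A (A^T *m y)).
rewrite -(@ler_pXn2r _ 2) // ?nnegrE ?sigma_max_ge0 ?sigma_min_tilde_ge0 //.
rewrite -(ler_pM2r (dotp_gt0 Ay0)); apply: le1 => j.
by rewrite finset.in_setT.
Qed.

End ColumnSubsets.

Section AbsMin.
Variables (R : realType) (n : nat) (x : 'cV[R]_n).

Lemma abs_min_le j : x j 0 != 0 -> abs_min x <= `|x j 0|.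
Proof.
by move=> xj; apply: ge_inf; [exists 0 => _ [k _ <-]|exists j].
Qed.

Lemma abs_min_gt0 : x != 0 -> 0 < abs_min x.
Proof.
move=> x0; have [j xj] : exists j, x j 0 != 0.
  apply: contrapT => nx; case/eqP: x0; apply/matrixP => j i.
  by rewrite ord1 mxE; apply/eqP; apply: contrapT => /negP ?; apply: nx; exists j.
pose e := \big[Num.min/1]_(j < n | x j 0 != 0) `|x j 0|.
have e0 : 0 < e by apply: lt_bigmin => // k; rewrite normr_gt0.
apply: lt_le_trans e0 _; apply: lb_le_inf; first by exists `|x j 0|; exists j.
by move=> _ [k xk <-]; exact: bigmin_le_cond.
Qed.

End AbsMin.

(** * The error bound *)

(** Shrinkage is the identity minus the projection onto [[- lambda, lambda]]; its continuity is read
    off from this form. *)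
Lemma shrinkE (R : realType) (lambda z : R) : 0 <= lambda ->
  shrink lambda z = z - Num.max (- lambda) (Num.min lambda z).
Proof.
move=> l0; case: (shrinkP l0 z) => [h|h|h1 h2].
- rewrite (_ : Num.min _ _ = lambda); last by apply/min_idPl/ltW.
  by rewrite (_ : Num.max _ _ = lambda) //; apply/max_idPr; lra.
- rewrite (_ : Num.min _ _ = z); last by apply/min_idPr; lra.
  by rewrite (_ : Num.max _ _ = - lambda) ?opprK //; apply/max_idPl/ltW.
- rewrite (_ : Num.min _ _ = z); last exact/min_idPr.
  by rewrite (_ : Num.max _ _ = z) ?subrr //; exact/max_idPr.
Qed.

Lemma shrink_continuous (R : realType) (lambda : R) : 0 <= lambda ->
  continuous (shrink lambda).
Proof.
move=> l0 z.
have -> : shrink lambda = fun z => z - Num.max (- lambda) (Num.min lambda z).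
  by apply/funext => ?; exact: shrinkE.
apply: (@continuousB _ _ _ id); first exact: cvg_id.
apply: (@continuous_max _ _ (fun=> - lambda) (fun z => Num.min lambda z)).
  exact: cst_continuous.
by apply: (@continuous_min _ _ (fun=> lambda) id);
  [exact: cst_continuous|exact: cvg_id].
Qed.

Lemma norm1_le_norm2 (R : realType) n (x : 'cV[R]_n) : norm1 x <= n%:R * norm2 x.
Proof.
apply: le_trans (ler_sum _ (fun j _ => coord_le_norm2 x j)) _.
by rewrite sumr_const card_ord mulr_natl.
Qed.

Lemma norm1D (R : realType) n (x y : 'cV[R]_n) : norm1 (x + y) <= norm1 x + norm1 y.
Proof.
by rewrite /norm1 -big_split; apply: ler_sum => j _; rewrite mxE ler_normD.
Qed.

Lemma norm1Z (R : realType) n (a : R) (x : 'cV[R]_n) :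
  norm1 (a *: x) = `|a| * norm1 x.
Proof. by rewrite /norm1 mulr_sumr; apply: eq_bigr => j _; rewrite mxE normrM. Qed.

Lemma norm2_mulmx_le (R : realType) m n (A : 'M[R]_(m, n)) (x : 'cV[R]_n) :
  norm2 (A *m x) <= normF A * norm2 x.
Proof.
rewrite -(@ler_pXn2r _ 2) // ?nnegrE ?mulr_ge0 ?norm2_ge0 ?normF_ge0 //.
by rewrite exprMn !sqr_norm2 dotp_mulmx_le.
Qed.

Lemma norm2N (R : realType) n (x : 'cV[R]_n) : norm2 (- x) = norm2 x.
Proof. by rewrite /norm2 dotpNl dotpNr opprK. Qed.

(* If [z] is outside the row space, so is [z + e] for small [e], because some
   coordinate of [z *m cokermx M] is nonzero; otherwise any [e] will do. *)
Lemma row_space_gap (R : realType) m n (M : 'M[R]_(m, n)) (z : 'rV[R]_n) :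
  exists2 delta, 0 < delta & forall e : 'rV_n,
    (forall j, `|e 0 j| < delta) -> ((z + e)%R <= M)%MS -> (e <= M)%MS.
Proof.
have [zM|zM] := boolP (z <= M)%MS.
  exists 1 => // e _ zeM.
  by rewrite -[e](addKr z) addmx_sub // -scaleN1r scalemx_sub.
have [k ck] : exists k, (z *m cokermx M) 0 k != 0.
  apply: contrapT => nk; move: zM; rewrite submxE => /eqP[].
  apply/matrixP => i k; rewrite ord1 [RHS]mxE; apply/eqP.
  by apply: contrapT => /negP ?; apply: nk; exists k.
pose c := (z *m cokermx M) 0 k; pose s := \sum_j `|cokermx M j k|.
have s0 : 0 <= s by exact: sumr_ge0.
exists (`|c| / (1 + s)) => [|e ed].
  by rewrite divr_gt0 ?normr_gt0 // ltr_wpDr.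
rewrite submxE mulmxDl addr_eq0 => /eqP/matrixP/(_ 0 k).
rewrite [RHS]mxE -/c => cE.
have : `|c| <= `|c| / (1 + s) * s.
  rewrite {1}cE normrN mxE mulr_sumr; apply: le_trans (ler_norm_sum _ _ _) _.
  by apply: ler_sum => j _; rewrite normrM ler_wpM2r // ltW.
have cs : `|c| = `|c| / (1 + s) * (1 + s) by rewrite divfK // gt_eqF // ltr_wpDr.
have c0 : 0 < `|c| / (1 + s) by rewrite divr_gt0 ?normr_gt0 // ltr_wpDr.
by rewrite {1}cs ler_pM2l //; lra.
Qed.

(** * The dual objective and its proximal points *)

Section DualObjective.
Variables (R : realType) (m n : nat) (A : 'M[R]_(m, n)) (b : 'cV[R]_m).
Variables (lambda : R) (xhat : 'cV[R]_n).
Hypotheses (lambda_gt0 : 0 < lambda) (Axhat : A *m xhat = b).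
Hypothesis xhat_min : forall x : 'cV[R]_n, A *m x = b ->
  sparse_obj lambda xhat <= sparse_obj lambda x.
Local Notation f := (sparse_obj lambda).
Local Notation S := (soft_shrink lambda).

Let lambda_ge0 : 0 <= lambda. Proof. exact: ltW. Qed.

(** This is the negative of the Lagrange dual function of the constrained problem, called h in the
    overview. *)
Definition dual_obj (y : 'cV[R]_m) : R :=
  2^-1 * dotp (S (A^T *m y)) (S (A^T *m y)) - dotp y b.

(** The distance at a dual point is the duality gap; weak duality, [dual_obj_ge], is its
    nonnegativity. *)
Lemma bregman_dual y :
  bregman f (A^T *m y) (S (A^T *m y)) xhat = f xhat + dual_obj y.
Proof.
by rewrite bregman_soft_shrink // dotp_mull trmxK Axhat /dual_obj addrA.
Qed.

Lemma dual_obj_ge y : - f xhat <= dual_obj y.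
Proof.
have := bregman_soft_shrink_ge lambda_ge0 (A^T *m y) xhat.
rewrite bregman_dual; have := dotp_ge0 (xhat - S (A^T *m y)); lra.
Qed.

Lemma dual_obj_smooth y v :
  dual_obj (y + v) <= dual_obj y + dotp (A *m S (A^T *m y) - b) v +
    2^-1 * dotp (A^T *m v) (A^T *m v).
Proof.
have := soft_shrink_conj_smooth lambda_ge0 (A^T *m y) (A^T *m (y + v)).
have -> : A^T *m (y + v) - A^T *m y = A^T *m v by rewrite mulmxDr addrC addKr.
by rewrite /dual_obj (dotpDl y v) dotpBl (dotp_mull A) (dotpC b v); lra.
Qed.

Lemma dual_obj_convex y v :
  dual_obj y + dotp (A *m S (A^T *m y) - b) v <= dual_obj (y + v).
Proof.
have := soft_shrink_conj_convex lambda_ge0 (A^T *m y) (A^T *m (y + v)).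
have -> : A^T *m (y + v) - A^T *m y = A^T *m v by rewrite mulmxDr addrC addKr.
by rewrite /dual_obj (dotpDl y v) dotpBl (dotp_mull A) (dotpC b v); lra.
Qed.

Lemma dual_obj_continuous : continuous dual_obj.
Proof.
pose F j (y : 'cV[R]_m) := shrink lambda ((A^T *m y) j 0) ^+ 2.
have -> : dual_obj = fun y => 2^-1 * (\sum_j F j y) - (b^T *m y) 0 0.
  apply/funext => y; rewrite /dual_obj -dotpE (dotpC b).
  congr (2^-1 * _ - _).
  by apply: eq_bigr => j _; rewrite soft_shrinkE /F expr2.
have cF : continuous (fun y => \sum_j F j y).
  apply: continuous_coord_sum => j y.
  apply: (@continuous_comp _ _ _ (fun y : 'cV_m => shrink lambda ((A^T *m y) j 0))
            (fun t => t ^+ 2)); last exact: exprn_continuous.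
  apply: (@continuous_comp _ _ _ (fun y : 'cV_m => (A^T *m y) j 0)).
    exact: mulmx_coord_continuous.
  exact: shrink_continuous.
move=> y; apply: (@continuousB _ _ _ (fun y => 2^-1 * (\sum_j F j y))
  (fun y => (b^T *m y) 0 0)).
  apply: (@continuousM _ _ (fun=> 2^-1)); first exact: cst_continuous.
  exact: cF.
exact: mulmx_coord_continuous.
Qed.

Lemma dual_prox (y : 'cV_m) (e : R) : 0 < e ->
  exists z, A *m S (A^T *m z) - b = e *: (y - z) /\
    dual_obj z + e / 2 * dotp (y - z) (y - z) <= dual_obj y.
Proof.
move=> e0; pose F z := dual_obj z + e / 2 * dotp (y - z) (y - z).
have cN : continuous (fun z : 'cV_m => dotp (y - z) (y - z)).
  have -> : (fun z : 'cV_m => dotp (y - z) (y - z)) =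
            fun z => dotp y y - 2 * (y^T *m z) 0 0 + dotp z z.
    by apply/funext => z; rewrite dotpBB (dotpE y z).
  move=> z; apply: (@continuousD _ _ _
    (fun z => dotp y y - 2 * (y^T *m z) 0 0) (fun z => dotp z z)); last first.
    exact: dotp_continuous.
  apply: (@continuousB _ _ _ (fun=> dotp y y) (fun z => 2 * (y^T *m z) 0 0)).
    exact: cst_continuous.
  apply: (@continuousM _ _ (fun=> 2) (fun z => (y^T *m z) 0 0)).
    exact: cst_continuous.
  exact: mulmx_coord_continuous.
have cF : continuous F.
  rewrite /F; move: (e / 2) => c z.
  apply: (@continuousD _ _ _ dual_obj (fun z => c * dotp (y - z) (y - z))).
    exact: dual_obj_continuous.
  apply: (@continuousM _ _ (fun=> c) (fun z : 'cV[R]_m => dotp (y - z) (y - z))).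
    exact: cst_continuous.
  exact: cN.
(* Since [dual_obj] is at least [- f xhat], this radius makes [F] at least [F y] outside the ball
   [C]. *)
pose r := 2 * (dual_obj y + f xhat) / e.
have r0 : 0 <= r.
  by rewrite divr_ge0 ?(ltW e0) //; have := dual_obj_ge y; lra.
pose C := [set z : 'cV_m | dotp (y - z) (y - z) <= r].
have clC : closed C.
  apply: (@preimage_closed _ _ (fun z : 'cV_m => dotp (y - z) (y - z))
            [set t | t <= r]).
    by move=> z _; exact: cN.
  exact: closed_le.
have Cy : C y by rewrite /C /= subrr dotp0l.
have [z Cz minz] : exists2 z, C z & forall v, C v -> F z <= F v.
  apply: (@EVT_min_cV _ _ _ _ (2 * dotp y y + 2 * r) cF clC); first by exists y.
  move=> v; rewrite /C /=; have vE : v = y - (y - v) by rewrite subKr.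
  move: vE; move: (y - v) => w -> Cw; rewrite dotpBB.
  (* This is [|y - w|^2 <= 2 |y|^2 + 2 |w|^2]. *)
  by have := dotp_ge0 (y + w); rewrite dotpDD; lra.
have Fy : F y = dual_obj y by rewrite /F subrr dotp0l mulr0 addr0.
have {}minz v : F z <= F v.
  have [/minz//|Cv] := pselect (C v).
  have {}Cv : r < dotp (y - v) (y - v) by rewrite ltNge; apply/negP.
  apply: le_trans (minz y Cy) _; rewrite Fy /F.
  have : e / 2 * r <= e / 2 * dotp (y - v) (y - v).
    by rewrite ler_wpM2l ?divr_ge0 ?(ltW e0) ?(ltW Cv).
  have -> : e / 2 * r = dual_obj y + f xhat by rewrite /r; field; rewrite gt_eqF.
  by have := dual_obj_ge v; lra.
exists z; split; last by rewrite -Fy; exact: minz.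
(* [g] is the gradient of [F] at [z]. Smoothness bounds [F (z + t g) - F z] by [t |g|^2 + O(t^2)],
   which therefore is nonnegative for every [t]. *)
pose g := A *m S (A^T *m z) - b - e *: (y - z).
suff : g == 0 by rewrite subr_eq0 => /eqP.
rewrite -dotp_eq0; apply/eqP.
apply: (@quadratic_ge0_lin0 _ _
  (2^-1 * dotp (A^T *m g) (A^T *m g) + e / 2 * dotp g g)) => t.
have := minz (z + t *: g); rewrite /F.
have := dual_obj_smooth z (t *: g).
rewrite -scalemxAr !(dotpZl, dotpZr) opprD addrA (dotpBB (y - z)) !(dotpZl, dotpZr).
have : dotp g g = dotp (A *m S (A^T *m z) - b) g - e * dotp (y - z) g.
  by rewrite {1}/g dotpBl dotpZl.
clearbody g.
set a := dotp g g; set c := dotp (_ - b) g; set a' := dotp (y - z) g.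
by move=> ->; lra.
Qed.

(** The midpoint of [x] and [xhat] is feasible, so its value is at least [f xhat]. It lies below the
    mean of the two values by at least [|x - xhat|^2 / 8]; doubling gives the factor [1/4]. *)
Lemma sparse_obj_strong_min x : A *m x = b ->
  4^-1 * dotp (x - xhat) (x - xhat) <= f x - f xhat.
Proof.
move=> Ax; have := xhat_min (x := 2^-1 *: (x + xhat)).
have half : 2^-1 + 2^-1 = 1 :> R by lra.
rewrite -scalemxAr mulmxDr Ax Axhat scalerDr -scalerDl half scale1r => /(_ erefl).
have n1 := norm1D x xhat.
have : lambda * norm1 (2^-1 *: (x + xhat)) <=
       lambda * (2^-1 * (norm1 x + norm1 xhat)).
  by rewrite ler_wpM2l // norm1Z ger0_norm // ler_wpM2l.
by rewrite /sparse_obj !sqr_norm2 dotpZl dotpZr dotpDD dotpBB; lra.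
Qed.

End DualObjective.

(** * Stability near the solution and the support argument *)

Section ErrorBound.
Variables (R : realType) (m n : nat) (A : 'M[R]_(m, n)) (b : 'cV[R]_m).
Variables (lambda : R) (xhat : 'cV[R]_n).
Hypotheses (lambda_gt0 : 0 < lambda) (Axhat : A *m xhat = b).
Hypothesis xhat_min : forall x : 'cV[R]_n, A *m x = b ->
  sparse_obj lambda xhat <= sparse_obj lambda x.
Local Notation f := (sparse_obj lambda).
Local Notation S := (soft_shrink lambda).

Let lambda_ge0 : 0 <= lambda. Proof. exact: ltW. Qed.

(** Applying the pseudoinverse to the residual gives a correction [w] that makes [x] feasible and
    raises [f] at most in proportion to the residual. Then [sparse_obj_strong_min] compares [x + w]
    with [xhat]. *)
Lemma sparse_obj_stable (K rho : R) : 0 <= K -> 0 < rho ->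
  exists2 tau, 0 < tau & forall x : 'cV_n, norm2 (A *m x - b) <= tau ->
    f x <= f xhat + K * norm2 (A *m x - b) ->
    (forall j, `|x j 0 - xhat j 0| < rho) /\ f xhat <= f x + rho.
Proof.
move=> K0 rho0; pose G := pinvmx A; pose g := normF G.
have l0 := lambda_gt0.
have g0 : 0 <= g := normF_ge0 G.
have f0 : 0 <= f xhat.
  by apply: le_trans (sparse_obj_ge lambda_ge0 _); rewrite mulr_ge0 ?dotp_ge0.
(* [C1] bounds [norm2 x] when the residual is at most 1; [C2] bounds the increase of [f] from [x] to
   [x + w] per unit of residual. *)
pose C1 := 1 + 2 * (f xhat + K).
have C10 : 0 <= C1 by rewrite /C1; lra.
pose C2 := lambda * (n%:R * g) + C1 * g + g ^+ 2.
have C20 : 0 <= C2 by rewrite /C2 !addr_ge0 ?mulr_ge0 ?sqr_ge0 ?ler0n // ltW.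
pose M := 1 + 4 * (C2 + K) + g + C2.
have M0 : 0 < M by rewrite /M; lra.
(* The 1 keeps the residual at most 1, [rho / 4] bounds [|w|] and the increase of [f], and
   [rho^2 / 8] bounds [|x + w - xhat|^2]. *)
exists (Num.min 1 (Num.min (rho / 4) (rho ^+ 2 / 8)) / M).
  by rewrite divr_gt0 // !lt_min ltr01 !divr_gt0 ?exprn_gt0.
move=> x; set p := A *m x - b; set s := norm2 p.
rewrite ler_pdivlMr // !le_min => /and3P[sM1 sM2 sM3] fx.
have s0 : 0 <= s := norm2_ge0 p.
have s1 : s <= 1 by move: sM1; rewrite /M; nra.
pose w := - (G *m p); have Aw : A *m (x + w) = b.
  have pE : p = A *m (x - xhat) by rewrite mulmxBr Axhat.
  rewrite /w mulmxDr mulmxN pE (mulmxA A G) (mulmxA (A *m G) A) mulmxKpV //.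
  by rewrite mulmxBr Axhat opprB addrC subrK.
have wg : norm2 w <= g * s by rewrite norm2N norm2_mulmx_le.
have w0 := norm2_ge0 w; have x0 := norm2_ge0 x.
have xC1 : norm2 x <= C1.
  have h := sparse_obj_ge lambda_ge0 x; rewrite -sqr_norm2 in h.
  have : K * s <= K by rewrite ler_piMr.
  by rewrite /C1; nra.
have fxw : f (x + w) <= f x + C2 * s.
  have h1 : lambda * norm1 (x + w) <= lambda * (norm1 x + n%:R * (g * s)).
    rewrite ler_wpM2l //; apply: le_trans (norm1D _ _) _.
    rewrite lerD2l; apply: le_trans (norm1_le_norm2 _) _.
    by rewrite ler_wpM2l.
  have h2 : dotp x w <= C1 * (g * s).
    apply: le_trans (ler_norm _) _; apply: le_trans (CauchySchwarz_norm2 _ _) _.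
    exact: ler_pM.
  have h3 : dotp w w <= g ^+ 2 * s.
    rewrite -sqr_norm2; apply: le_trans (_ : (g * s) ^+ 2 <= _).
      by rewrite ler_pXn2r // ?nnegrE ?mulr_ge0.
    by rewrite exprMn ler_wpM2l ?sqr_ge0 // expr2 ler_piMr.
  have h4 : 0 <= g ^+ 2 * s by rewrite mulr_ge0 ?sqr_ge0.
  by rewrite /sparse_obj /C2 !sqr_norm2 dotpDD; lra.
have Cs0 : 0 <= C2 * s by rewrite mulr_ge0.
have Ks0 : 0 <= K * s by rewrite mulr_ge0.
have gs0 : 0 <= g * s by rewrite mulr_ge0.
have sM : s * M = s + 4 * (C2 * s + K * s) + g * s + C2 * s by rewrite /M; ring.
rewrite sM in sM2 sM3.
split; last by have := xhat_min Aw; lra.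
move=> j; have N2 := sparse_obj_strong_min lambda_gt0 Axhat xhat_min Aw.
pose N := norm2 (x + w - xhat).
have Nrho : N < rho / 2.
  rewrite -(@ltr_pXn2r _ 2) // ?nnegrE ?norm2_ge0 ?divr_ge0 ?(ltW rho0) //.
  rewrite sqr_norm2; have r2 : 0 < rho ^+ 2 by rewrite exprn_gt0.
  by rewrite expr_div_n; lra.
have := coord_le_norm2 (x + w - xhat) j; rewrite -/N => hN.
have := coord_le_norm2 w j => hw.
have -> : x j 0 - xhat j 0 = (x + w - xhat) j 0 - w j 0 by rewrite !mxE; ring.
apply: le_lt_trans (ler_normB _ _) _.
by lra.
Qed.

(* On the support of [v], A^T y is [v - xhat] plus a vector taking one of
   finitely many values, one for each sign pattern of [v]; take the smallest of
   their gaps. *)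
Lemma support_pattern_range :
  exists2 delta, 0 < delta & forall (y : 'cV_m) (v : 'cV_n),
    (forall j, v j 0 != 0 -> (A^T *m y) j 0 = v j 0 + lambda * Num.sg (v j 0)) ->
    (forall j, `|v j 0 - xhat j 0| < delta) ->
    exists u : 'cV_m, forall j, v j 0 != 0 -> v j 0 - xhat j 0 = (A^T *m u) j 0.
Proof.
pose pattern := {ffun 'I_n -> bool * bool}.
pose M (s : pattern) : 'M[R]_(m, n) := \matrix_(i, j) if (s j).1 then A i j else 0.
pose z (s : pattern) : 'rV[R]_n :=
  \row_j if (s j).1 then xhat j 0 + lambda * (if (s j).2 then 1 else -1) else 0.
have /choice[delta deltaP] s : exists delta, 0 < delta /\ forall e : 'rV_n,
    (forall j, `|e 0 j| < delta) -> ((z s + e)%R <= M s)%MS -> (e <= M s)%MS.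
  by have [delta ? ?] := row_space_gap (M s) (z s); exists delta.
exists (\big[Num.min/1]_s delta s).
  by apply: lt_bigmin => // s _; case: (deltaP s).
move=> y v vy vx; pose s : pattern := [ffun j => (v j 0 != 0, 0 < v j 0)].
have lt_delta j : `|v j 0 - xhat j 0| < delta s.
  exact: lt_le_trans (vx j) (bigmin_le _ _ _).
have delta0 : 0 < delta s by case: (deltaP s).
pose e : 'rV[R]_n := \row_j if v j 0 != 0 then v j 0 - xhat j 0 else 0.
have /submxP[c ec] : (e <= M s)%MS.
  case: (deltaP s) => _; apply.
    by move=> j; rewrite mxE; case: ifP; rewrite ?normr0.
  apply/submxP; exists y^T; apply/matrixP => i j; rewrite ord1 !mxE ffunE /=.
  have [vj0|vj0] := eqVneq (v j 0) 0.
    by rewrite addr0 big1 // => k _; rewrite !mxE ffunE vj0 eqxx /= mulr0.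
  have sgE : (if 0 < v j 0 then 1 else -1) = Num.sg (v j 0).
    by have [/gtr0_sg|/ltr0_sg|/eqP] := ltrgt0P (v j 0); rewrite ?(negPf vj0).
  have := vy j vj0; rewrite mxE sgE => vyj.
  have -> : xhat j 0 + lambda * Num.sg (v j 0) + (v j 0 - xhat j 0) =
            v j 0 + lambda * Num.sg (v j 0) by ring.
  by rewrite -vyj; apply: eq_bigr => k _; rewrite !mxE ffunE vj0 /= mulrC.
exists c^T => j vj0; have := congr1 (fun r : 'rV_n => r 0 j) ec.
rewrite !mxE vj0 => ->; apply: eq_bigr => k _.
by rewrite !mxE ffunE vj0 /= mulrC.
Qed.

(** With [v = S z' - xhat], Cauchy-Schwarz is applied to [e |d|^2 = <v, A^T d>]. The range condition
    bounds [|v|] by a multiple of [e |d|], and strong monotonicity bounds the part of [A^T d] that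
    matters. *)
Lemma restricted_strong_convexity (mu rho e : R) (z z' : 'cV[R]_n) :
  0 < e -> 0 < rho -> rho < mu ->
  (forall j, xhat j 0 != 0 -> mu <= `|xhat j 0|) ->
  (forall j, `|S z' j 0 - xhat j 0| < rho) ->
  A != 0 ->
  (exists u : 'cV_m, forall j, S z' j 0 != 0 ->
     S z' j 0 - xhat j 0 = (A^T *m u) j 0) ->
  forall d : 'cV_m, A *m S z' - b = e *: d -> z - z' = A^T *m d ->
  sigma_min_tilde A ^+ 2 * (mu - rho) * dotp d d <=
  (mu - rho + 2 * lambda) * dotp (A^T *m d) (S z - S z').
Proof.
move=> e0 rho0 rho_mu xhat_mu close A0 [u0 u0P] d dE uE.
have l0 := lambda_gt0.
(* As [rho < mu], closeness puts the support of [xhat] inside that of [S z']; so [v] vanishes off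
   [J]. *)
have supp j : S z' j 0 = 0 -> xhat j 0 = 0.
  move=> zj; apply/eqP; apply: contraT => /xhat_mu; have := close j.
  by rewrite zj sub0r normrN; lra.
pose v := S z' - xhat.
have vE j : v j 0 = S z' j 0 - xhat j 0 by rewrite /v mxE [X in _ + X]mxE.
have Av : A *m v = e *: d by rewrite /v mulmxBr Axhat dE.
pose J : {set 'I_n} := finset.finset (fun j => S z' j 0 != 0).
have sv : sigma_min_tilde A ^+ 2 * dotp v v <= e ^+ 2 * dotp d d.
  have := @sigma_min_tilde_restrict _ _ _ A J u0 v A0.
  rewrite Av dotpZl dotpZr mulrA -expr2; apply=> j; rewrite finset.inE.
    by rewrite negbK => /eqP zj; rewrite vE zj supp // subrr.
  by move=> zj; rewrite -u0P // vE.
pose u := A^T *m d.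
pose psi j := u j 0 * (S z j 0 - S z' j 0).
have zz j : z j 0 - z' j 0 = u j 0 by rewrite /u -uE !mxE.
have psi0 j : 0 <= psi j by rewrite /psi -zz !soft_shrinkE shrink_mono.
pose th := (mu - rho) / (mu - rho + 2 * lambda).
have den0 : 0 < mu - rho + 2 * lambda by lra.
(* Where [xhat] vanishes, either the term is not positive, or [u] points away from zero and
   shrinkage has slope 1. Elsewhere [|S z'|] is at least [mu - rho], so the slope is at least
   [th]. *)
have good j : v j 0 * u j 0 <= 0 \/ th * u j 0 ^+ 2 <= psi j.
  rewrite /th mulrAC ler_pdivrMr //.
  have [xj|xj] := eqVneq (xhat j 0) 0.
    rewrite vE xj subr0; have [|neg] := lerP (S z' j 0 * u j 0) 0; first by left.
    right; have sj : S z' j 0 != 0.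
      by apply: contraTneq neg => ->; rewrite mul0r ltxx.
    have sh : shrink lambda (z j 0) - shrink lambda (z' j 0) = z j 0 - z' j 0.
      apply: shrink_same_sign => //; rewrite -soft_shrinkE //.
      by rewrite zz mulrC ltW.
    have -> : psi j = u j 0 ^+ 2 by rewrite /psi !soft_shrinkE sh zz expr2.
    by have := sqr_ge0 (u j 0); nra.
  right; have muj := xhat_mu j xj; have clj := close j.
  have sj : mu - rho <= `|S z' j 0|.
    have : `|xhat j 0| <= `|S z' j 0| + `|S z' j 0 - xhat j 0|.
      by rewrite -[X in `|X| <= _](subKr (S z' j 0)) ler_normB.
    by lra.
  have sj0 : shrink lambda (z' j 0) != 0.
    by rewrite -soft_shrinkE -normr_gt0; lra.
  have := shrink_restricted_strong_mono lambda_ge0 (z j 0) sj0.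
  rewrite -!soft_shrinkE zz -/(psi j).
  have := psi0 j; have [hle|hlt] := lerP (u j 0 ^+ 2) (psi j); first nra.
  by nra.
(* Dropping the nonpositive terms can only increase [<v, u>], and the slope bound [th] holds on all
   that remain. *)
pose u' : 'cV[R]_n := \col_j if v j 0 * u j 0 <= 0 then 0 else u j 0.
have vu' : dotp v u <= dotp v u'.
  apply: ler_sum => j _; rewrite [u' j 0]mxE; case: ifP => // h.
  by rewrite mulr0.
have thu' : th * dotp u' u' <= dotp u (S z - S z').
  rewrite mulr_sumr; apply: ler_sum => j _; rewrite [u' j 0]mxE.
  have -> : (S z - S z') j 0 = S z j 0 - S z' j 0.
    by rewrite [LHS]mxE [X in _ + X]mxE.
  case: ifP => h; first by rewrite mul0r mulr0; exact: psi0.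
  by have [vu|] := good j; [rewrite vu in h|rewrite expr2].
have dd : e * dotp d d = dotp v u by rewrite dotp_mulr trmxK Av dotpZl.
have th0 : 0 < th by rewrite divr_gt0 // subr_gt0.
have d0 := dotp_ge0 d.
set Q := dotp u (S z - S z') in thu' *.
have Q0 : 0 <= Q by apply: le_trans thu'; rewrite mulr_ge0 ?dotp_ge0 ?ltW.
suff key : sigma_min_tilde A ^+ 2 * th * dotp d d <= Q.
  by move: key; rewrite /th mulrA mulrAC ler_pdivrMr // mulrC (mulrC Q).
have [d00|dn0] := eqVneq (dotp d d) 0; first by rewrite d00 mulr0.
have dpos : 0 < dotp d d by rewrite lt_def dn0.
have cs : (e * dotp d d) ^+ 2 <= dotp v v * dotp u' u'.
  apply: le_trans (CauchySchwarz v u'); rewrite ler_pXn2r // ?nnegrE.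
  - by rewrite dd.
  - by rewrite mulr_ge0 // ltW.
  - by apply: le_trans vu'; rewrite -dd mulr_ge0 // ltW.
set sg2 := sigma_min_tilde A ^+ 2 in sv *.
have sg0 : 0 <= sg2 by rewrite sqr_ge0.
have : sg2 * th * (e * dotp d d) ^+ 2 <= e ^+ 2 * dotp d d * Q.
  apply: le_trans (_ : sg2 * th * (dotp v v * dotp u' u') <= _).
    by rewrite ler_wpM2l // mulr_ge0 // ltW.
  have -> : sg2 * th * (dotp v v * dotp u' u') =
            (sg2 * dotp v v) * (th * dotp u' u') by ring.
  by rewrite ler_pM // mulr_ge0 ?dotp_ge0 // ltW.
have -> : sg2 * th * (e * dotp d d) ^+ 2 =
          e ^+ 2 * dotp d d * (sg2 * th * dotp d d) by ring.
by rewrite ler_pM2l // mulr_gt0 // exprn_gt0.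
Qed.

End ErrorBound.

Section BregmanErrorBound.
Variables (R : realType) (m n : nat) (A : 'M[R]_(m, n)) (b : 'cV[R]_m).
Variables (lambda : R) (xhat : 'cV[R]_n).
Hypotheses (lambda_gt0 : 0 < lambda) (Axhat : A *m xhat = b).
Hypothesis xhat_min : forall x : 'cV[R]_n, A *m x = b ->
  sparse_obj lambda xhat <= sparse_obj lambda x.
Local Notation f := (sparse_obj lambda).
Local Notation S := (soft_shrink lambda).

Let lambda_ge0 : 0 <= lambda. Proof. exact: ltW. Qed.

Lemma bregman_error_bound_approx (mu rho : R) (y : 'cV[R]_m) :
  A != 0 -> 0 < rho -> rho < mu ->
  (forall j, xhat j 0 != 0 -> mu <= `|xhat j 0|) ->
  sigma_min_tilde A ^+ 2 * (mu - rho) *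
    (bregman f (A^T *m y) (S (A^T *m y)) xhat - 2 * rho) <=
  (mu - rho + 2 * lambda) *
    dotp (A *m S (A^T *m y) - b) (A *m S (A^T *m y) - b).
Proof.
move=> A0 rho0 rho_mu xhat_mu; have l0 := lambda_gt0.
set x := S (A^T *m y); set D := bregman _ _ _ _; set r := A *m x - b.
have [delta delta0 deltaP] := support_pattern_range A lambda xhat.
have rho'0 : 0 < Num.min rho delta by rewrite lt_min rho0.
(* [K = norm2 y] is the multiplier in the bound on [f xe - f xhat] obtained below from [ypE] and
   [breg0]. *)
have [tau1 tau10 stable] :=
  sparse_obj_stable lambda_gt0 Axhat xhat_min (norm2_ge0 y) rho'0.
have y1 : 0 < 1 + norm2 y by rewrite ltr_wpDr ?norm2_ge0.
(* The second term ensures [norm2 y * tau <= rho]. *)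
pose tau := Num.min tau1 (rho / (1 + norm2 y)).
have tau0 : 0 < tau by rewrite lt_min tau10 divr_gt0.
have D0 : 0 <= D.
  apply: le_trans (bregman_soft_shrink_ge lambda_ge0 _ _).
  by rewrite mulr_ge0 ?dotp_ge0.
(* Since [e |d|^2 <= 2 D], this choice gives [|A xe - b|^2 = e^2 |d|^2 <= tau^2]. *)
pose e := tau ^+ 2 / (2 * D + 1).
have D1 : 0 < 2 * D + 1 by lra.
have e0 : 0 < e by rewrite divr_gt0 ?exprn_gt0.
have [z [pE zle]] := dual_prox lambda_gt0 Axhat y e0.
set xe := S (A^T *m z) in pE; pose d := y - z; rewrite -/d in pE zle.
have DE : D = f xhat + dual_obj A b lambda y := bregman_dual lambda_gt0 Axhat y.
have zge := dual_obj_ge lambda_gt0 Axhat z.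
have pe : norm2 (A *m xe - b) <= tau.
  rewrite pE -(@ler_pXn2r _ 2) // ?nnegrE ?norm2_ge0 ?(ltW tau0) //.
  rewrite sqr_norm2 dotpZl dotpZr.
  have -> : tau ^+ 2 = e * (2 * D + 1) by rewrite divfK // gt_eqF.
  by rewrite ler_pM2l //; lra.
have zd : z = y - d by rewrite subKr.
(* Replacing [z] by [y = z + d] only adds [e |d|^2]. *)
have ypE : dotp z (A *m xe - b) <= norm2 y * norm2 (A *m xe - b).
  apply: le_trans (le_trans (ler_norm _) (CauchySchwarz_norm2 y _)).
  rewrite {1}zd dotpBl gerBl pE dotpZr mulr_ge0 ?dotp_ge0 //.
  exact: ltW.
have bregE : bregman f (A^T *m z) xe xhat = f xhat - f xe + dotp z (A *m xe - b).
  by rewrite /bregman dotp_mull trmxK mulmxBr Axhat !dotpBr; lra.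
have breg0 : 0 <= bregman f (A^T *m z) xe xhat.
  apply: le_trans (bregman_soft_shrink_ge lambda_ge0 _ _).
  by rewrite mulr_ge0 ?dotp_ge0.
have [close fxe] : (forall j, `|xe j 0 - xhat j 0| < Num.min rho delta) /\
    f xhat <= f xe + Num.min rho delta.
  apply: stable; first by apply: le_trans pe _; rewrite ge_min lexx.
  by lra.
have range : exists u : 'cV_m, forall j, xe j 0 != 0 ->
    xe j 0 - xhat j 0 = (A^T *m u) j 0.
  apply: (deltaP z) => j; last first.
    by have := close j; rewrite lt_min => /andP[].
  by rewrite soft_shrinkE => /(shrink_neq0 lambda_ge0).
have close' j : `|xe j 0 - xhat j 0| < rho.
  by have := close j; rewrite lt_min => /andP[].
have uE : A^T *m y - A^T *m z = A^T *m d by rewrite mulmxBr.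
have := restricted_strong_convexity lambda_gt0 Axhat e0 rho0 rho_mu xhat_mu
  close' A0 range pE uE.
rewrite -/x -/xe dotp_mull trmxK mulmxBr.
have -> : A *m x - A *m xe = r - (A *m xe - b).
  by rewrite /r opprB addrA subrK.
rewrite (dotpBr r) pE (dotpZr e) => strong.
have d0 := dotp_ge0 d.
(* By convexity [D] is at most [<d, r>] plus the distance at [z], and the latter is at most
   [2 rho]. *)
have Dle : D - 2 * rho <= dotp d r.
  have := dual_obj_convex A b lambda_gt0 y (z - y).
  rewrite (addrC y) subrK -/x -/r -(opprB y z) -/d (dotpNr d) (dotpC r) => convex.
  have := bregman_dual lambda_gt0 Axhat z; rewrite -/xe bregE => bz.
  have minle : Num.min rho delta <= rho by rewrite ge_min lexx.
  have : norm2 y * norm2 (A *m xe - b) <= rho.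
    apply: le_trans (_ : norm2 y * (rho / (1 + norm2 y)) <= _).
      rewrite ler_wpM2l ?norm2_ge0 //; apply: le_trans pe _.
      by rewrite ge_min lexx orbT.
    rewrite mulrCA ger_pMr // ler_pdivrMr // mul1r lerDr //.
  by lra.
set a := sigma_min_tilde A ^+ 2 * (mu - rho) in strong *.
set k := mu - rho + 2 * lambda in strong *.
have a0 : 0 <= a by rewrite mulr_ge0 ?sqr_ge0 //; lra.
have k0 : 0 < k by rewrite /k; lra.
have ed0 : 0 <= e * dotp d d by rewrite mulr_ge0 // ltW.
have {}strong : a * dotp d d <= k * dotp d r.
  by apply: le_trans strong _; rewrite ler_pM2l // gerBl.
have r0 := dotp_ge0 r.
(* From [a |d|^2 <= k <d, r>], Cauchy-Schwarz gives [a <d, r>^2 <= k <d, r> |r|^2]; a positive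
   [<d, r>] cancels. *)
apply: le_trans (_ : a * dotp d r <= _); first by rewrite ler_wpM2l.
have t0 : 0 <= dotp d r.
  by rewrite -(pmulr_rge0 _ k0); apply: le_trans strong; rewrite mulr_ge0.
have [->|tn0] := eqVneq (dotp d r) 0; first by rewrite mulr0 mulr_ge0 // ltW.
have tpos : 0 < dotp d r by rewrite lt_def tn0.
rewrite -(ler_pM2r tpos); apply: le_trans (_ : a * (dotp d d * dotp r r) <= _).
  by rewrite -mulrA -expr2 ler_wpM2l // CauchySchwarz.
by rewrite mulrA (mulrAC k) ler_wpM2r.
Qed.

Lemma bregman_error_bound (y : 'cV[R]_m) : A != 0 -> xhat != 0 ->
  sigma_min_tilde A ^+ 2 * abs_min xhat *
    bregman f (A^T *m y) (S (A^T *m y)) xhat <=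
  (abs_min xhat + 2 * lambda) *
    dotp (A *m S (A^T *m y) - b) (A *m S (A^T *m y) - b).
Proof.
move=> A0 xhat0; have mu0 := abs_min_gt0 xhat0; set mu := abs_min xhat in mu0 *.
have muP j : xhat j 0 != 0 -> mu <= `|xhat j 0| by exact: abs_min_le.
set D := bregman _ _ _ _; set r := A *m _ - b.
have D0 : 0 <= D.
  apply: le_trans (bregman_soft_shrink_ge lambda_ge0 _ _).
  by rewrite mulr_ge0 ?dotp_ge0.
set s := sigma_min_tilde A ^+ 2; have s0 : 0 <= s by rewrite sqr_ge0.
have c0 : 0 < s * (D + 2 * mu) + 1 by rewrite ltr_wpDl // mulr_ge0 //; lra.
apply/ler_addgt0Pr => eps eps0.
(* The loss in the approximate bound is at most [rho * s * (D + 2 * mu)], which this choice keeps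
   below [eps]. *)
pose rho := Num.min (mu / 2) (eps / (s * (D + 2 * mu) + 1)).
have rho0 : 0 < rho by rewrite lt_min !divr_gt0.
have rho_mu : rho < mu.
  by apply: le_lt_trans (_ : mu / 2 < _); [rewrite ge_min lexx|lra].
have rho_eps : rho * (s * (D + 2 * mu)) <= eps.
  apply: le_trans (_ : rho * (s * (D + 2 * mu) + 1) <= _).
    by rewrite ler_wpM2l ?(ltW rho0) // lerDl.
  by rewrite -ler_pdivlMr // ge_min lexx orbT.
have := @bregman_error_bound_approx mu rho y A0 rho0 rho_mu muP.
rewrite -/D -/r -/s => approx.
have rr : 0 <= rho * dotp r r by rewrite mulr_ge0 ?dotp_ge0 // ltW.
have srr : 0 <= s * (rho * rho) := mulr_ge0 s0 (mulr_ge0 (ltW rho0) (ltW rho0)).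
by nra.
Qed.

End BregmanErrorBound.

(** * Mean descent of one step *)

Section BatchMoments.
Variables (R : realType) (I J : finType) (p : I -> R).
Hypothesis sum_p : \sum_i p i = 1.

Definition batch_prob (e : {ffun J -> I}) : R := \prod_j p (e j).

(** Independence within a batch, in algebraic form: a product of sums expands over all functions
    [e]. *)
Lemma batch_mean_prod (G : J -> I -> R) :
  \sum_e batch_prob e * \prod_j G j (e j) = \prod_j \sum_i p i * G j i.
Proof.
by rewrite bigA_distr_bigA; apply: eq_bigr => e _; rewrite -big_split.
Qed.

Lemma sum_batch_prob : \sum_e batch_prob e = 1.
Proof.
transitivity (\sum_e batch_prob e * \prod_(j : J) 1).
  by apply: eq_bigr => e _; rewrite big1_eq mulr1.
rewrite (batch_mean_prod (fun _ _ => 1)) big1 // => j _.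
by under eq_bigr do rewrite mulr1.
Qed.

Lemma batch_mean1 (j0 : J) (g : I -> R) :
  \sum_e batch_prob e * g (e j0) = \sum_i p i * g i.
Proof.
pose G j i := if j == j0 then g i else 1.
transitivity (\sum_e batch_prob e * \prod_j G j (e j)).
  apply: eq_bigr => e _; congr (_ * _).
  by rewrite (bigD1 j0) //= /G eqxx big1 ?mulr1 // => j /negPf ->.
rewrite batch_mean_prod (bigD1 j0) //= /G eqxx.
rewrite [X in _ * X]big1 ?mulr1 // => j /negPf ->.
by under eq_bigr do rewrite mulr1.
Qed.

Lemma batch_mean2 (j0 j1 : J) (g h : I -> R) : j1 != j0 ->
  \sum_e batch_prob e * (g (e j0) * h (e j1)) =
  (\sum_i p i * g i) * (\sum_i p i * h i).
Proof.
move=> j10.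
pose G j i := if j == j0 then g i else if j == j1 then h i else 1.
transitivity (\sum_e batch_prob e * \prod_j G j (e j)).
  apply: eq_bigr => e _; congr (_ * _).
  rewrite (bigD1 j0) //= /G eqxx; congr (_ * _).
  rewrite (bigD1 j1) //= (negPf j10) eqxx big1 ?mulr1 //.
  by move=> j /andP[/negPf -> /negPf ->].
rewrite batch_mean_prod (bigD1 j0) //= /G eqxx; congr (_ * _).
rewrite (bigD1 j1) //= (negPf j10) eqxx [X in _ * X]big1 ?mulr1 //.
move=> j /andP[/negPf -> /negPf ->].
by under eq_bigr do rewrite mulr1.
Qed.

Variables (n : nat) (v : I -> 'cV[R]_n).
Let V := \sum_i p i *: v i.

Lemma dotp_suml (K : finType) (F : K -> 'cV[R]_n) u :
  dotp (\sum_k F k) u = \sum_k dotp (F k) u.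
Proof.
apply: (big_ind2 (fun x y => dotp x u = y)) => //; first exact: dotp0l.
by move=> x1 y1 x2 y2 <- <-; rewrite dotpDl.
Qed.

Lemma dotp_sumr (K : finType) (F : K -> 'cV[R]_n) u :
  dotp u (\sum_k F k) = \sum_k dotp u (F k).
Proof. by rewrite dotpC dotp_suml; apply: eq_bigr => k _; rewrite dotpC. Qed.

Lemma batch_mean_dotp (u : 'cV[R]_n) :
  \sum_e batch_prob e * dotp (\sum_j v (e j)) u =
  #|J|%:R * \sum_i p i * dotp (v i) u.
Proof.
under eq_bigr do rewrite dotp_suml mulr_sumr.
rewrite exchange_big /=.
under eq_bigr do rewrite (batch_mean1 _ (fun i => dotp (v i) u)).
by rewrite sumr_const mulr_natl.
Qed.

Lemma batch_mean_pair (j0 j1 : J) :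
  \sum_e batch_prob e * dotp (v (e j0)) (v (e j1)) =
  if j1 == j0 then \sum_i p i * dotp (v i) (v i) else dotp V V.
Proof.
case: eqVneq => [->|j10]; first exact: (batch_mean1 j0 (fun i => dotp (v i) (v i))).
under eq_bigr do rewrite /dotp mulr_sumr.
rewrite exchange_big /=; apply: eq_bigr => l _.
rewrite (batch_mean2 (fun i => v i l 0) (fun i => v i l 0) j10).
by rewrite /V summxE; congr (_ * _); apply: eq_bigr => i _; rewrite mxE.
Qed.

(** Expand the square over pairs of positions. Diagonal pairs give the second moment; the others
    factor by independence. *)
Lemma batch_mean_norm :
  \sum_e batch_prob e * dotp (\sum_j v (e j)) (\sum_j v (e j)) =
  #|J|%:R * \sum_i p i * dotp (v i) (v i) + #|J|%:R * (#|J|%:R - 1) * dotp V V.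
Proof.
transitivity (\sum_(j0 : J) \sum_(j1 : J)
    \sum_e batch_prob e * dotp (v (e j0)) (v (e j1))).
  under [RHS]eq_bigr do rewrite exchange_big.
  rewrite [RHS]exchange_big; apply: eq_bigr => e _ /=.
  rewrite dotp_suml mulr_sumr; apply: eq_bigr => j0 _.
  by rewrite dotp_sumr mulr_sumr.
under eq_bigr do under eq_bigr do rewrite batch_mean_pair.
set a := (X in _ = _ * X + _); set c := dotp V V.
have rowE j0 : \sum_(j1 : J) (if j1 == j0 then a else c) = a + (#|J|%:R - 1) * c.
  rewrite (bigD1 j0) //= eqxx; congr (_ + _).
  transitivity (\sum_(j1 | j1 != j0) c); first by apply: eq_bigr => j /negPf ->.
  apply: (addrI c); transitivity (\sum_(j1 : J) c).
    by rewrite [RHS](bigD1 j0).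
  by rewrite sumr_const -mulr_natl; ring.
under eq_bigr do rewrite rowE.
by rewrite sumr_const -mulr_natl; ring.
Qed.

End BatchMoments.

(** Cauchy-Schwarz on [|A^T r|^2 = <r, A A^T r>] transfers the bound to the transpose without
    comparing spectra. *)
Lemma dotp_tr_le_sigma_max (R : realType) m n (A : 'M[R]_(m, n)) (r : 'cV_m) :
  dotp (A^T *m r) (A^T *m r) <= sigma_max A ^+ 2 * dotp r r.
Proof.
set a := dotp _ _; have a0 : 0 <= a := dotp_ge0 _.
have [->|an0] := eqVneq a 0; first by rewrite mulr_ge0 ?sqr_ge0 ?dotp_ge0.
have apos : 0 < a by rewrite lt_def an0.
have aE : a = dotp r (A *m (A^T *m r)) by rewrite dotp_mulr.
rewrite -(ler_pM2r apos) -expr2 {1}aE; apply: le_trans (CauchySchwarz _ _) _.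
by rewrite (mulrC (_ ^+ 2)) -mulrA ler_wpM2l ?dotp_ge0 ?dotp_le_sigma_max.
Qed.

(** Test the operator bound on the [i]-th basis vector. *)
Lemma diag_le_sigma_max (R : realType) m (w : 'I_m -> R) i :
  w i <= sigma_max (diag_mx (\row_i w i)).
Proof.
have := dotp_le_sigma_max (diag_mx (\row_i w i)) (delta_mx i 0).
have d1 : dotp (delta_mx i 0) (delta_mx i 0) = 1 :> R.
  rewrite /dotp (bigD1 i) //= !mxE !eqxx mulr1 big1 ?addr0 // => j /negPf ji.
  by rewrite !mxE ji mul0r.
have -> : diag_mx (\row_i w i) *m delta_mx i 0 = w i *: delta_mx i 0 :> 'cV_m.
  apply/matrixP => j k; rewrite mul_diag_mx !mxE.
  by case: eqVneq => [->|]; rewrite ?mulr0.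
rewrite dotpZl dotpZr d1 !mulr1 -expr2 => h.
apply: le_trans (ler_norm _) _.
rewrite -(@ler_pXn2r _ 2) // ?nnegrE ?sigma_max_ge0 //.
by rewrite real_normK // num_real.
Qed.

Lemma coupling_entry (R : realType) m n (A : 'M[R]_(m, n)) (p w : 'I_m -> R)
    (c : R) :
  (forall i, row i A != 0) ->
  let D : 'M[R]_m := diag_mx (\row_i norm2 (rowv A i)) in
  diag_mx (\row_i p i) *m diag_mx (\row_i w i) *m invmx (D *m D) = c%:M ->
  forall i, p i * w i = c * dotp (rowv A i) (rowv A i).
Proof.
move=> hA D PW i.
have a0 k : norm2 (rowv A k) != 0.
  by rewrite gt_eqF // norm2_gt0 // -trmx_eq0 trmxK.
have uD : D *m D \in unitmx.
  rewrite unitmx_mul unitmxE unitfE det_diag; apply/andP.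
  by split; apply/prodf_neq0 => k _; rewrite mxE.
have /matrixP/(_ i i) := congr1 (mulmx^~ (D *m D)) PW.
rewrite mulmxKV // mul_scalar_mx !mulmx_diag !mxE eqxx !mulr1n.
by rewrite -sqr_norm2 expr2.
Qed.

Section Descent.
Variables (R : realType) (m n eta : nat) (A : 'M[R]_(m, n)) (b : 'cV[R]_m).
Variables (lambda alpha : R) (xhat : 'cV[R]_n) (p w : 'I_m -> R).
Hypotheses (A_rows : forall i, row i A != 0) (lambda_ge0 : 0 <= lambda).
Hypotheses (Axhat : A *m xhat = b) (sum_p : \sum_i p i = 1).
Hypothesis eta_gt0 : (0 < eta)%N.
Hypothesis alpha_gt0 : 0 < alpha.
Let c := alpha / normF A ^+ 2.
Hypothesis pw : forall i, p i * w i = c * dotp (rowv A i) (rowv A i).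
Local Notation f := (sparse_obj lambda).
Local Notation S := (soft_shrink lambda).
Local Notation W := (diag_mx (\row_i w i)).

Definition kaczmarz_dir (x : 'cV[R]_n) (i : 'I_m) : 'cV[R]_n :=
  (w i * ((dotp (rowv A i) x - b i 0) / norm2 (rowv A i) ^+ 2)) *: rowv A i.

Definition rska_step (z : 'cV[R]_n) (e : 'I_eta -> 'I_m) : 'cV[R]_n :=
  z - eta%:R^-1 *: \sum_(j < eta) kaczmarz_dir (S z) (e j).

Let residual z := A *m S z - b.

Lemma residualE z i : dotp (rowv A i) (S z) - b i 0 = residual z i 0.
Proof. by rewrite -mulmx_rowv /residual [RHS]mxE [X in _ = _ + X]mxE. Qed.

Lemma residual_xhat z i : dotp (rowv A i) (S z - xhat) = residual z i 0.
Proof.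
by rewrite dotpBr -!mulmx_rowv Axhat /residual [RHS]mxE [X in _ = _ + X]mxE.
Qed.

Let a i := dotp (rowv A i) (rowv A i).

Lemma row_norm_gt0 i : 0 < a i.
Proof. by rewrite dotp_gt0 // -trmx_eq0 trmxK. Qed.

(** The coupling cancels the row norms: in the mean, [kaczmarz_dir] is the gradient of
    [c / 2 * |A x - b|^2]. *)
Lemma mean_dir_dotp z :
  \sum_i p i * dotp (kaczmarz_dir (S z) i) (S z - xhat) =
  c * dotp (residual z) (residual z).
Proof.
rewrite /dotp mulr_sumr; apply: eq_bigr => i _.
rewrite -/(dotp _ _) /kaczmarz_dir dotpZl residualE residual_xhat sqr_norm2 -/(a i).
have -> : p i * (w i * (residual z i 0 / a i) * residual z i 0) =
          p i * w i / a i * (residual z i 0 * residual z i 0) by ring.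
by rewrite pw mulfK // gt_eqF // row_norm_gt0.
Qed.

Lemma mean_dir z : \sum_i p i *: kaczmarz_dir (S z) i = c *: (A^T *m residual z).
Proof.
apply/matrixP => j k; rewrite ord1 summxE [RHS]mxE [X in _ = _ * X]mxE mulr_sumr.
apply: eq_bigr => i _; rewrite mxE [X in _ * X = _]mxE residualE sqr_norm2 -/(a i).
have -> : p i * (w i * (residual z i 0 / a i) * rowv A i j 0) =
          p i * w i / a i * (residual z i 0 * rowv A i j 0) by ring.
rewrite pw mulfK ?gt_eqF ?row_norm_gt0 //.
by rewrite !mxE; ring.
Qed.

Lemma normF_gt0 : 0 < normF A ^+ 2.
Proof.
have [i _|m0] := pickP 'I_m; last first.
  have := sum_p; rewrite big1 => [/esym/eqP|i]; last by have := m0 i.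
  by rewrite oner_eq0.
rewrite sqr_normF (bigD1 i) //=; apply: ltr_pwDl; first exact: row_norm_gt0.
by apply: sumr_ge0 => k _; exact: dotp_ge0.
Qed.

(** One of the two weights is absorbed by the coupling, the other is bounded by [sigma_max W]. *)
Lemma mean_dir_norm_le z :
  \sum_i p i * dotp (kaczmarz_dir (S z) i) (kaczmarz_dir (S z) i) <=
  c * sigma_max W * dotp (residual z) (residual z).
Proof.
rewrite /dotp mulr_sumr; apply: ler_sum => i _.
rewrite -/(dotp _ _) /kaczmarz_dir dotpZl dotpZr residualE sqr_norm2 -/(a i).
have -> : p i * (w i * (residual z i 0 / a i) *
            (w i * (residual z i 0 / a i) * a i)) =
          p i * w i / a i * w i * (a i / a i) *
            (residual z i 0 * residual z i 0) by ring.
have ai0 : a i != 0 by rewrite gt_eqF // row_norm_gt0.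
rewrite pw mulfK // divff // mulr1 ler_wpM2r -?expr2 ?sqr_ge0 //.
rewrite ler_wpM2l ?diag_le_sigma_max // divr_ge0 ?sqr_ge0 //.
exact: ltW.
Qed.

(** This is [L(alpha)]. *)
Definition rska_gain : R := alpha - alpha / (2 * eta%:R) *
  (alpha / normF A ^+ 2 * (eta%:R - 1) * sigma_max A ^+ 2 + sigma_max W).

Lemma rska_mean_descent (z : 'cV[R]_n) : (forall i, 0 <= p i) ->
  \sum_(e : {ffun 'I_eta -> 'I_m}) batch_prob p e *
    bregman f (rska_step z e) (S (rska_step z e)) xhat <=
  bregman f z (S z) xhat -
    rska_gain / normF A ^+ 2 * dotp (residual z) (residual z).
Proof.
move=> p0; set D := bregman f z (S z) xhat; set rr := dotp _ _.
pose g (e : {ffun 'I_eta -> 'I_m}) := \sum_(j < eta) kaczmarz_dir (S z) (e j).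
have step e : batch_prob p e * bregman f (rska_step z e) (S (rska_step z e)) xhat <=
    D * batch_prob p e - eta%:R^-1 * (batch_prob p e * dotp (g e) (S z - xhat)) +
    2^-1 * eta%:R^-1 ^+ 2 * (batch_prob p e * dotp (g e) (g e)).
  have pe0 : 0 <= batch_prob p e by apply: prodr_ge0.
  have := bregman_step_le lambda_ge0 z (rska_step z e) xhat.
  rewrite -/D (_ : rska_step z e - z = - (eta%:R^-1 *: g e)); last first.
    by rewrite /rska_step addrC addKr.
  rewrite !dotpNl dotpNr !dotpZl dotpZr => /(ler_wpM2l pe0) /le_trans; apply.
  by rewrite le_eqVlt; apply/orP; left; apply/eqP; ring.
apply: le_trans (ler_sum _ (fun e _ => step e)) _.
rewrite big_split /= sumrB -!mulr_sumr sum_batch_prob // mulr1.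
rewrite batch_mean_dotp // batch_mean_norm // mean_dir_dotp mean_dir.
rewrite card_ord dotpZl dotpZr -/rr.
have e0 : 0 < eta%:R :> R by rewrite ltr0n.
have e1 : 0 <= eta%:R - 1 :> R by rewrite subr_ge0 ler1n.
have N0 := normF_gt0.
have c0 : 0 < c by rewrite divr_gt0.
have h1 := mean_dir_norm_le z; have h2 := dotp_tr_le_sigma_max A (residual z).
rewrite -/rr in h1 h2.
set Q1 := \sum_i _ in h1 *; set Q2 := dotp (A^T *m _) _ in h2 *.
set X := sigma_max A ^+ 2 in h2 *; set sW := sigma_max W in h1 *.
have -> : rska_gain / normF A ^+ 2 =
    c - c / (2 * eta%:R) * (c * (eta%:R - 1) * X + sW).
  rewrite /rska_gain -/X -/sW /c; move: N0; set N := normF A ^+ 2 => N0.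
  by field; rewrite !gt_eqF.
have -> : D - eta%:R^-1 * (eta%:R * (c * rr)) + 2^-1 * eta%:R^-1 ^+ 2 *
    (eta%:R * Q1 + eta%:R * (eta%:R - 1) * (c * (c * Q2))) =
  D - c * rr + (2 * eta%:R)^-1 * (Q1 + (eta%:R - 1) * (c * (c * Q2))).
  by field; rewrite gt_eqF.
(* In this form the two sides differ only in the terms compared by [h1] and [h2]. *)
have -> : D - (c - c / (2 * eta%:R) * (c * (eta%:R - 1) * X + sW)) * rr =
  D - c * rr +
    (2 * eta%:R)^-1 * (c * sW * rr + (eta%:R - 1) * (c * (c * (X * rr)))).
  by field; rewrite gt_eqF.
rewrite lerD2l ler_wpM2l ?invr_ge0 ?mulr_ge0 ?ler0n //.
rewrite lerD // ler_wpM2l // ler_wpM2l ?(ltW c0) // ler_wpM2l // (ltW c0) //.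
Qed.

End Descent.

(** * Expectations of the iterates *)

Section Sampling.
Variables (R : realType) (d : measure_display) (T : measurableType d).
Variables (P : probability T R) (m eta : nat) (p : 'I_m -> R).
Variable tau : nat -> 'I_eta -> T -> 'I_m.
Hypothesis iid : iid_sampling P p tau.
Variables (I : finType) (phi : I -> nat * 'I_eta).
Hypothesis phi_inj : injective phi.

Definition sample (t : T) : {ffun I -> 'I_m} :=
  [ffun i => tau (phi i).1 (phi i).2 t].

(** At [kj = phi i] this is the singleton of [z i]. Quantifying over [i] avoids inverting [phi] and
    fits the form of independence in [iid_sampling]. *)
Let B (z : {ffun I -> 'I_m}) (kj : nat * 'I_eta) : set 'I_m :=
  [set c | forall i, phi i = kj -> c = z i].

Lemma sample_preimage z : sample @^-1` [set z] =
  \bigcap_(kj in [set` [seq phi i | i <- enum I]])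
    (tau kj.1 kj.2 @^-1` B z kj).
Proof.
apply/seteqP; split => t /=.
  by move=> <- kj _ i <-; rewrite ffunE.
move=> h; apply/ffunP => i; rewrite ffunE.
by apply: (h (phi i)) => //=; rewrite map_f // mem_enum.
Qed.

Lemma measurable_sample z : measurable (sample @^-1` [set z]).
Proof.
rewrite sample_preimage; apply: fin_bigcap_measurable; first exact: finite_seq.
by move=> kj _; case: iid.
Qed.

Lemma prob_sample z : P (sample @^-1` [set z]) = (batch_prob p z)%:E.
Proof.
case: iid => _ Pp indep; rewrite sample_preimage indep; last first.
  by rewrite map_inj_uniq ?enum_uniq.
rewrite big_map big_enum /= /batch_prob -prodEFin; apply: eq_bigr => i _.
rewrite -(Pp (phi i).1 (phi i).2 (z i)); congr (P (_ @^-1` _)).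
apply/seteqP; split => [c /(_ i erefl) //|c /= ->].
by move=> i' /phi_inj ->.
Qed.

(** [sample] takes finitely many values, so the integrand is a finite sum of weighted indicators. *)
Lemma expectation_sample (F : {ffun I -> 'I_m} -> R) : (forall z, 0 <= F z) ->
  ('E_P[fun t => F (sample t)] = (\sum_z batch_prob p z * F z)%:E)%E.
Proof.
move=> F0; rewrite unlock.
transitivity (\int[P]_t (\sum_z (F z)%:E * (\1_(sample @^-1` [set z]) t)%:E))%E.
  apply: eq_integral => t _; rewrite (bigD1 (sample t)) //= big1 => [|z zt].
    by rewrite indicE mem_set // mule1 adde0.
  rewrite indicE memNset ?mule0 // => /= zt'.
  by rewrite zt' eqxx in zt.
have mind z : measurable_fun setT
    (fun t => (\1_(sample @^-1` [set z]) t)%:E : \bar R).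
  by apply/measurable_EFinP; apply: measurable_indic; exact: measurable_sample.
rewrite ge0_integral_sum //=; last first.
- by move=> z t _; rewrite mule_ge0 // lee_fin.
- by move=> z; apply: measurable_funeM; exact: mind.
rewrite -sumEFin; apply: eq_bigr => z _.
transitivity ((F z)%:E * \int[P]_t (\1_(sample @^-1` [set z]) t)%:E)%E.
  by apply: ge0_integralZl_EFin => // t _; rewrite lee_fin.
rewrite integral_indic // ?setIT; last exact: measurable_sample.
by rewrite EFinM [RHS]muleC; congr (_ * _)%E; exact: prob_sample.
Qed.

End Sampling.

(** The primal iterate is the shrinkage of the dual one, also at step 0 where both are 0; hence only
    dual iterates need to be followed. *)
Lemma rskaS (R : realType) m n eta (A : 'M[R]_(m, n)) (b : 'cV_m) (lambda : R)
    (w : 'I_m -> R) (tau : nat -> 'I_eta -> 'I_m) k :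
  rska A b lambda w tau k =
    (soft_shrink lambda (rska A b lambda w tau k).2, (rska A b lambda w tau k).2) /\
  (rska A b lambda w tau k.+1).2 =
    rska_step A b lambda w (rska A b lambda w tau k).2 (tau k).
Proof.
have fst k' : rska A b lambda w tau k' =
    (soft_shrink lambda (rska A b lambda w tau k').2, (rska A b lambda w tau k').2).
  case: k' => [|k'] /=; first by rewrite soft_shrink0.
  by case: (rska _ _ _ _ _ _).
by split => //=; rewrite fst.
Qed.

(** The start is 0 and each step subtracts a combination of rows. This makes the error bound
    applicable. *)
Lemma rska_dual_range (R : realType) m n eta (A : 'M[R]_(m, n)) (b : 'cV_m)
    (lambda : R) (w : 'I_m -> R) (tau : nat -> 'I_eta -> 'I_m) k :
  exists y : 'cV_m, (rska A b lambda w tau k).2 = A^T *m y.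
Proof.
elim: k => [|k [y yE]]; first by exists 0; rewrite mulmx0.
have rowvE i : rowv A i = A^T *m delta_mx i 0.
  by rewrite /rowv tr_row -colE.
rewrite (rskaS _ _ _ _ _ k).2 /rska_step yE.
under eq_bigr do rewrite /kaczmarz_dir rowvE scalemxAr.
by rewrite -mulmx_sumr scalemxAr -mulmxBr; eexists.
Qed.

Lemma eq_rska (R : realType) m n eta (A : 'M[R]_(m, n)) (b : 'cV_m)
    (lambda : R) (w : 'I_m -> R) (tau tau' : nat -> 'I_eta -> 'I_m) k :
  (forall l j, (l < k)%N -> tau l j = tau' l j) ->
  rska A b lambda w tau k = rska A b lambda w tau' k.
Proof.
elim: k => //= k IHk eq_tau.
rewrite IHk => [|l j lk]; last by rewrite eq_tau // ltnW.
case: (rska _ _ _ _ _ _) => x xs; congr (soft_shrink _ (xs - _ *: _), xs - _ *: _);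
  by apply: eq_bigr => j _; rewrite eq_tau.
Qed.

(** * The step-size condition and the rate *)

Section Rate.
Variable R : realFieldType.
Implicit Types E N X W al st th : R.

(** [E], [N], [X], [W], [al] stand for [eta], [normF A ^+ 2], [sigma_max A ^+ 2], [sigma_max W],
    [alpha]. The gain is a positive multiple of the slack in the bound on [al]. *)
Lemma rate_gain_gt0 E N X W al : 0 < N -> 0 <= X -> 1 < E -> 0 < al ->
  al < 2 * ((E - 2^-1 * W) * N / (X * (E - 1))) ->
  0 < al - al / (2 * E) * (al / N * (E - 1) * X + W).
Proof.
move=> N0 X0 E1 al0 al_lt.
(* Division by zero returns 0, so [X = 0] would give [al < 0]. *)
have Xn0 : X != 0.
  by apply: contraTneq al_lt => ->; rewrite mul0r invr0 !mulr0 -leNgt ltW.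
have Xpos : 0 < X by rewrite lt_def Xn0.
have XE0 : 0 < X * (E - 1) by rewrite mulr_gt0 // subr_gt0.
have E0 : 0 < E by lra.
move: al_lt; rewrite mulrA ltr_pdivlMr // => al_lt.
have -> : al - al / (2 * E) * (al / N * (E - 1) * X + W) =
  al / (2 * E * N) * (2 * ((E - 2^-1 * W) * N) - al * (X * (E - 1))).
  by field; rewrite !gt_eqF.
by rewrite mulr_gt0 ?divr_gt0 ?mulr_gt0 // subr_gt0.
Qed.

(** With [s = X / N <= 1] and [al <= W], the gain is at most [al - s al^2 / 2]. Times [s], this is
    [t - t^2 / 2 <= 1/2] at [t = s al]. The bound keeps [q] positive. *)
Lemma rate_gain_le E N X W al st : 0 < N -> 0 <= st -> st <= X -> X <= N ->
  1 < E -> 0 < al -> al <= W ->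
  st * ((al - al / (2 * E) * (al / N * (E - 1) * X + W)) / N) <= 2^-1.
Proof.
move=> N0 st0 stX XN E1 al0 alW; have E0 : 0 < E by lra.
set L := _ - _.
have [L0|L0] := lerP L 0.
  apply: le_trans (_ : 0 <= _) => //; rewrite mulr_ge0_le0 //.
  by rewrite mulr_le0_ge0 // invr_ge0 ltW.
pose s := X / N; have s0 : 0 <= s by rewrite divr_ge0 ?(ltW N0) // (le_trans st0).
have s1 : s <= 1 by rewrite ler_pdivrMr // mul1r.
apply: le_trans (_ : s * L <= _).
  by rewrite mulrA mulrAC ler_wpM2r ?(ltW L0) // ler_wpM2r // invr_ge0 ltW.
have L1 : L <= al - al / (2 * E) * (al * (E * s)).
  rewrite /L lerD2l lerN2 ler_wpM2l //.
    by rewrite divr_ge0 ?mulr_ge0 ?(ltW al0) ?(ltW E0).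
  have -> : al / N * (E - 1) * X = al * ((E - 1) * s).
    by rewrite /s; field; rewrite gt_eqF.
  apply: le_trans (_ : al * ((E - 1) * s) + al <= _); last by rewrite lerD2l.
  by nra.
apply: le_trans (ler_wpM2l s0 L1) _.
have -> : s * (al - al / (2 * E) * (al * (E * s))) = s * al - 2^-1 * (s * al) ^+ 2.
  by field; rewrite gt_eqF.
by have := sqr_ge0 (s * al - 1); nra.
Qed.

End Rate.

(** * Separating the past from the current batch *)

Section SumType.
Variables (R : realType) (I J K : finType).

Definition ffun_join (c : {ffun J -> I}) (e : {ffun K -> I}) : {ffun J + K -> I} :=
  [ffun i => match i with inl j => c j | inr k => e k end].

Lemma sum_ffun_join (F : {ffun J + K -> I} -> R) :
  \sum_z F z = \sum_c \sum_e F (ffun_join c e).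
Proof.
rewrite pair_big (reindex (fun ce => ffun_join ce.1 ce.2)) //=.
exists (fun z => ([ffun j => z (inl j)], [ffun k => z (inr k)])) => [[c e]|z] _ /=.
  by congr (_, _); apply/ffunP => i; rewrite !ffunE.
by apply/ffunP => -[j|k]; rewrite !ffunE.
Qed.

Lemma batch_prob_join (p : I -> R) c e :
  batch_prob p (ffun_join c e) = batch_prob p c * batch_prob p e.
Proof.
rewrite /batch_prob big_sumType /=.
by congr (_ * _); apply: eq_bigr => i _; rewrite ffunE.
Qed.

End SumType.

Section ExpectedIterates.
Variables (R : realType) (m n eta : nat) (A : 'M[R]_(m, n)) (b : 'cV[R]_m).
Variables (lambda : R) (p w : 'I_m -> R).
Variables (d : measure_display) (T : measurableType d) (P : probability T R).
Variable tau : nat -> 'I_eta -> T -> 'I_m.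
Hypotheses (iid : iid_sampling P p tau) (i0 : 'I_m).

Let past k (lj : 'I_k * 'I_eta) : nat * 'I_eta := (nat_of_ord lj.1, lj.2).

Let past_batch k (i : ('I_k * 'I_eta) + 'I_eta) : nat * 'I_eta :=
  match i with inl lj => past lj | inr j => (k, j) end.

Let past_inj k : injective (@past k).
Proof. by move=> [l j] [l' j'] [/ord_inj -> ->]. Qed.

Let past_batch_inj k : injective (@past_batch k).
Proof.
move=> [[l j]|j] [[l' j']|j'] //= [].
- by move=> /ord_inj -> ->.
- by move=> lk; have := ltn_ord l; rewrite lk ltnn.
- by move=> lk; have := ltn_ord l'; rewrite -lk ltnn.
- by move=> ->.
Qed.

(* Draws from step [k] on are irrelevant to the [k]-th iterate; they are set to
   [i0]. *)
Definition draws k (c : {ffun 'I_k * 'I_eta -> 'I_m}) (l : nat) (j : 'I_eta) :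
    'I_m :=
  if insub l is Some l' then c (l', j) else i0.

Definition dual_iterate k (c : {ffun 'I_k * 'I_eta -> 'I_m}) : 'cV[R]_n :=
  (rska A b lambda w (draws c) k).2.

Lemma dual_iterateE k t (c : {ffun 'I_k * 'I_eta -> 'I_m}) :
  (forall l j, c (l, j) = tau l j t) ->
  (rska A b lambda w (fun l j => tau l j t) k).2 = dual_iterate c.
Proof.
move=> ct; congr (_.2); apply: eq_rska => l j lk.
by rewrite /draws insubT ct.
Qed.

Lemma expectation_dual_iterate k (F : 'cV[R]_n -> R) : (forall z, 0 <= F z) ->
  ('E_P[fun t => F (rska A b lambda w (fun l j => tau l j t) k).2] =
   (\sum_(c : {ffun 'I_k * 'I_eta -> 'I_m})
      batch_prob p c * F (dual_iterate c))%:E)%E.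
Proof.
move=> F0.
rewrite -(expectation_sample iid (@past_inj k)
            (F := fun c => F (dual_iterate c))) //.
congr expectation; apply/funext => t; congr F; apply: dual_iterateE => l j.
by rewrite ffunE.
Qed.

(** Batch [k] is independent of the draws that determine iterate [k], so the joint law factors and
    the inner sum is a one-step mean. *)
Lemma expectation_dual_iterateS k (F : 'cV[R]_n -> R) : (forall z, 0 <= F z) ->
  ('E_P[fun t => F (rska A b lambda w (fun l j => tau l j t) k.+1).2] =
   (\sum_(c : {ffun 'I_k * 'I_eta -> 'I_m}) batch_prob p c *
      \sum_(e : {ffun 'I_eta -> 'I_m}) batch_prob p e *
        F (rska_step A b lambda w (dual_iterate c) e))%:E)%E.
Proof.
move=> F0; pose H (z : {ffun ('I_k * 'I_eta) + 'I_eta -> 'I_m}) :=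
  F (rska_step A b lambda w (dual_iterate [ffun lj => z (inl lj)])
       (fun j => z (inr j))).
transitivity ('E_P[fun t => H (sample tau (@past_batch k) t)])%E.
  congr expectation; apply/funext => t.
  have [_ ->] := rskaS A b lambda w (fun l j => tau l j t) k; rewrite /H.
  congr (F (rska_step A b lambda w _ _)).
    by apply: dual_iterateE => l j; rewrite !ffunE.
  by apply/funext => j; rewrite ffunE.
rewrite (expectation_sample iid (@past_batch_inj k)); last by move=> z; exact: F0.
congr (_%:E).
rewrite sum_ffun_join; apply: eq_bigr => c _; rewrite mulr_sumr.
apply: eq_bigr => e _; rewrite batch_prob_join /H -mulrA.
congr (_ * (_ * F (rska_step A b lambda w (dual_iterate _) _))).
  by apply/ffunP => lj; rewrite !ffunE.
by apply/funext => j; rewrite ffunE.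
Qed.

End ExpectedIterates.

(** * Linear convergence in expectation *)

Theorem theorem4p8 (R : realType) (m n : nat) (A : 'M[R]_(m, n))
    (b : 'cV[R]_m) (lambda : R) (xhat : 'cV[R]_n)
    (eta : nat) (p w : 'I_m -> R) (alpha : R)
    (d : measure_display) (T : measurableType d) (P : probability T R)
    (tau : nat -> 'I_eta -> T -> 'I_m)
    (hA : forall i : 'I_m, row i A != 0)
    (hb0 : b != 0)
    (hb : exists z : 'cV[R]_n, A *m z = b)
    (hlambda : 0 < lambda)
    (hxhat : A *m xhat = b)
    (hxhat_min : forall x : 'cV[R]_n, A *m x = b ->
       sparse_obj lambda xhat <= sparse_obj lambda x)
    (heta : (1 < eta)%N)
    (hp : forall i : 'I_m, 0 <= p i)
    (hp1 : \sum_(i < m) p i = 1)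
    (hcoupling :
       let Pm : 'M[R]_m := diag_mx (\row_i p i) in
       let W : 'M[R]_m := diag_mx (\row_i w i) in
       let D : 'M[R]_m := diag_mx (\row_i norm2 (rowv A i)) in
       Pm *m W *m invmx (D *m D) = (alpha / normF A ^+ 2)%:M)
    (halpha : 0 < alpha)
    (halpha_lt :
       let W : 'M[R]_m := diag_mx (\row_i w i) in
       alpha < 2 * ((eta%:R - 2^-1 * sigma_max W) * normF A ^+ 2
                    / (sigma_max A ^+ 2 * (eta%:R - 1))))
    (htau : iid_sampling P p tau) :
  let W : 'M[R]_m := diag_mx (\row_i w i) in
  let gamma := (sigma_min_tilde A ^+ 2)^-1 *
    ((abs_min xhat + 2 * lambda) / abs_min xhat) in
  let L := alpha - alpha / (2 * eta%:R) *
    (alpha / normF A ^+ 2 * (eta%:R - 1) * sigma_max A ^+ 2 + sigma_max W) in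
  let q := 1 - gamma^-1 * (L / normF A ^+ 2) in
  let f := sparse_obj lambda in
  let x := fun (k : nat) (t : T) =>
    (rska A b lambda w (fun l j => tau l j t) k).1 in
  let xs := fun (k : nat) (t : T) =>
    (rska A b lambda w (fun l j => tau l j t) k).2 in
  [/\ 0 < q < 1,
      forall k : nat,
        ('E_P[fun t => bregman f (xs k.+1 t) (x k.+1 t) xhat]
         <= q%:E * 'E_P[fun t => bregman f (xs k t) (x k t) xhat])%E &
      forall k : nat,
        ('E_P[fun t => (norm2 (x k t - xhat) ^+ 2)%R]
         <= (2 * q ^+ k * f xhat)%:E)%E].
Proof.
move=> W gamma L q f x xs.
have lambda_ge0 := ltW hlambda.
have alpha_lt : alpha < 2 * ((eta%:R - 2^-1 * sigma_max W) * normF A ^+ 2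
    / (sigma_max A ^+ 2 * (eta%:R - 1))) := halpha_lt.
(* Otherwise the bound on [alpha], a division by zero, would be 0. *)
have sigma_max_neq0 : sigma_max A != 0.
  apply: contraTneq alpha_lt => ->.
  by rewrite expr0n /= mul0r invr0 !mulr0 -leNgt ltW.
have A0 : A != 0.
  apply: contra_neq sigma_max_neq0 => A0; apply/eqP.
  rewrite eq_le sigma_max_ge0 andbT; apply: le_trans (sigma_max_le_normF A) _.
  rewrite A0 /normF big1 ?sqrtr0 // => i _.
  by rewrite big1 // => j _; rewrite mxE expr0n.
have xhat0 : xhat != 0.
  by apply: contra_neq hb0 => xh0; rewrite -hxhat xh0 mulmx0.
have [i0] : exists i0 : 'I_m, True.
  have [i0 _|m0] := pickP 'I_m; first by exists i0.
  have := hp1; rewrite big1 => [/esym/eqP|i]; last by have := m0 i.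
  by rewrite oner_eq0.
have pw := coupling_entry hA hcoupling.
have N0 : 0 < normF A ^+ 2 := normF_gt0 hA hp1.
have eta1 : 1 < eta%:R :> R by rewrite ltr1n.
have eta0 : (0 < eta)%N := ltnW heta.
have L0 : 0 < L := rate_gain_gt0 N0 (sqr_ge0 _) eta1 halpha alpha_lt.
have mu0 := abs_min_gt0 xhat0; set mu := abs_min xhat in mu0.
have st0 := sigma_min_tilde_gt0 A0.
have gammaV : gamma^-1 = sigma_min_tilde A ^+ 2 * (mu / (mu + 2 * lambda)).
  rewrite /gamma -/mu; field; rewrite !gt_eqF //; lra.
(* By the coupling, [alpha] is the mean of the weights under [p]. *)
have alW : alpha <= sigma_max W.
  have -> : alpha = \sum_i p i * w i.
    under eq_bigr do rewrite pw.
    by rewrite -mulr_sumr -sqr_normF divfK // gt_eqF.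
  rewrite -[leRHS]mul1r -hp1 mulr_suml; apply: ler_sum => i _.
  by rewrite ler_wpM2l // diag_le_sigma_max.
have th0 : 0 < mu / (mu + 2 * lambda) by rewrite divr_gt0 //; lra.
have th1 : mu / (mu + 2 * lambda) <= 1 by rewrite ler_pdivrMr; lra.
have gain0 : 0 < L / normF A ^+ 2 by rewrite divr_gt0.
have q01 : 0 < q < 1.
  (* With [th1], this bounds [1 - q] by one half. *)
  have half : sigma_min_tilde A ^+ 2 * (L / normF A ^+ 2) <= 2^-1.
    apply: rate_gain_le => //; first exact: sqr_ge0.
      by rewrite ler_pXn2r ?nnegrE ?sigma_min_tilde_ge0 ?sigma_max_ge0
                 ?sigma_min_tilde_le_max.
    by rewrite ler_pXn2r ?nnegrE ?normF_ge0 ?sigma_max_ge0 ?sigma_max_le_normF.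
  have h0 : 0 < sigma_min_tilde A ^+ 2 * (L / normF A ^+ 2).
    by rewrite mulr_gt0 // exprn_gt0.
  by rewrite /q gammaV mulrAC; apply/andP; split; nra.
pose D z := bregman f z (soft_shrink lambda z) xhat.
have D_ge z : 2^-1 * dotp (xhat - soft_shrink lambda z)
                          (xhat - soft_shrink lambda z) <= D z.
  exact: bregman_soft_shrink_ge.
have D0 z : 0 <= D z by apply: le_trans (D_ge z); rewrite mulr_ge0 ?dotp_ge0.
(* The error bound turns the mean descent into a contraction at points of the form [A^T y]. *)
have contract y : \sum_(e : {ffun 'I_eta -> 'I_m}) batch_prob p e *
    D (rska_step A b lambda w (A^T *m y) e) <= q * D (A^T *m y).
  apply: le_trans (rska_mean_descent hA lambda_ge0 hxhat hp1 eta0 halpha pw _ hp) _.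
  have := bregman_error_bound hlambda hxhat hxhat_min y A0 xhat0.
  rewrite -/(D _) -/mu; set rr := dotp _ _ => bound.
  have {}bound : gamma^-1 * D (A^T *m y) <= rr.
    rewrite gammaV -(ler_pM2l (_ : 0 < mu + 2 * lambda)); last lra.
    apply: le_trans bound; rewrite le_eqVlt; apply/orP; left; apply/eqP.
    by field; rewrite gt_eqF //; lra.
  have := ler_wpM2l (ltW gain0) bound.
  rewrite -/(D _) -/rr (_ : rska_gain _ _ _ _ = L) // /q.
  by move: (L / _) (D _) gamma^-1 => g Dy gi; lra.
pose M k := \sum_(c : {ffun 'I_k * 'I_eta -> 'I_m})
  batch_prob p c * D (dual_iterate A b lambda w i0 c).
have xE k t : x k t = soft_shrink lambda (xs k t).
  by rewrite /x (rskaS _ _ _ _ _ k).1.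
have bp0 (J : finType) (c : {ffun J -> 'I_m}) : 0 <= batch_prob p c.
  exact: prodr_ge0.
have EM k : ('E_P[fun t => bregman f (xs k t) (x k t) xhat] = (M k)%:E)%E.
  rewrite -(expectation_dual_iterate A b lambda w htau i0 k D0).
  by congr expectation; apply/funext => t; rewrite xE.
have MS k : M k.+1 <= q * M k.
  rewrite -lee_fin -(expectation_dual_iterate A b lambda w htau i0 k.+1 D0).
  rewrite (expectation_dual_iterateS A b lambda w htau i0 k D0) lee_fin.
  rewrite mulr_sumr; apply: ler_sum => c _; rewrite mulrCA ler_wpM2l //.
  have [y yE] := rska_dual_range A b lambda w (draws i0 c) k.
  rewrite /dual_iterate yE.
  exact: contract.
split=> // k; first by rewrite !EM -EFinM lee_fin.
have Mk : M k <= q ^+ k * f xhat.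
  elim: k => [|k IHk].
    (* Both iterates start at 0, where the conjugate vanishes. *)
    have D00 : D 0 = f xhat.
      by rewrite /D bregman_soft_shrink // soft_shrink0 !dotp0l mulr0 addr0 subr0.
    by rewrite /M /dual_iterate /= D00 -mulr_suml sum_batch_prob // expr0.
  apply: le_trans (MS k) _; rewrite exprS -mulrA ler_wpM2l //.
  by case/andP: q01 => /ltW.
pose N z := norm2 (soft_shrink lambda z - xhat) ^+ 2.
have NE : (fun t => norm2 (x k t - xhat) ^+ 2) = (fun t => N (xs k t)).
  by apply/funext => t; rewrite xE.
rewrite NE (expectation_dual_iterate A b lambda w htau i0 k (F := N)); last first.
  by move=> z; rewrite sqr_ge0.
rewrite lee_fin; apply: le_trans (_ : 2 * M k <= _); last first.
  by rewrite -mulrA ler_wpM2l.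
rewrite mulr_sumr; apply: ler_sum => c _; rewrite [leRHS]mulrCA ler_wpM2l //.
(* Strong convexity bounds the squared error by [2 D]. *)
have := D_ge (dual_iterate A b lambda w i0 c).
by rewrite /N sqr_norm2 -opprB dotpNl dotpNr opprK; lra.
Qed.
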